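(* One-root hollow heaps, with operations as defined in the context, correctly implement all the heap operations (every operation returns the item or heap prescribed by its specification), maintain every heap as a heap-ordered tree, and maintain at all times the following rank invariant: a node $u$ of rank $r$ has exactly $r$ ranked children, of ranks $0,1,\ldots,r-1$, unless $r>2$ and $u$ was made hollow by a decrease-key, in which case $u$ has exactly two ranked children, of ranks $r-2$ and $r-1$ (a node may have any number of unranked children).
   Context: Heaps. A heap stores a finite set of items, each with a key from a totally ordered universe, and supports: make-heap() (return an empty heap); find-min($h$) (return an item of minimum key in $h$, or null if $h$ is empty); insert($e,k,h$) (add item $e$, which is in no heap, with key $k$); delete-min($h$) (delete from non-empty $h$ the item that find-min($h$) returns); meld($h_1,h_2$) (return a heap containing all items of the item-disjoint heaps $h_1,h_2$); decrease-key($e,k,h$) (given an item $e$ in $h$ with key greater than $k$, change its key to $k$); delete($e,h$) (delete item $e$ from $h$). Heaps passed as arguments are destroyed; decrease-key and delete are given the location of $e$. Nodes. Nodes hold items: each node holds at most one item, and is full if it holds one and hollow otherwise; each item in a heap is held by exactly one node; a newly created node is full and a hollow node never becomes full again. Each node $u$ has a key $u.key$ (the current key of its item if $u$ is full; if $u$ is hollow, the key its item had just before leaving $u$) and a non-negative integer rank $u.rank$. A tree (or dag) of nodes with arcs from parent to child is heap-ordered if $v.key\le w.key$ for every arc $(v,w)$. For two full roots, link makes the one of larger key (ties broken arbitrarily) a child of the other; the new child is the loser and the other the winner. A ranked link is a link of two roots of equal rank and increases the winner's rank by one; an unranked link may be applied to any two full roots and changes no ranks. One-root hollow heap. It is either empty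 or a single heap-ordered rooted tree of nodes whose root is full; the root is the minimum node. A non-root node is a ranked or unranked child according to whether the link it lost was ranked or unranked; a child keeps this status when moved to a new parent. make-heap returns an empty heap; find-min returns the item in the root; meld returns one heap if the other is empty, and otherwise does an unranked link of the two roots; insert($e,k,h$) creates a new full node of rank 0 holding $e$ with key $k$ and melds this one-node heap with $h$. decrease-key($e,k,h$), with $u$ the node holding $e$: if $u$ is the root one may simply set $u.key=k$; otherwise create a new node $v$, move $e$ from $u$ to $v$ (so $u$ becomes hollow), set $v.key=k$ and $v.rank=\max\{0,u.rank-2\}$, move to $v$ every ranked child of $u$ of rank less than $v.rank$ and any subset of the unranked children of $u$ (with their subtrees), and meld the tree rooted at $v$ with the heap. delete($e,h$) removes $e$ from the node $u$ holding it, making $u$ hollow; if $u$ is not the root this completes the operation; otherwise, while some root is hollow, destroy such a root, making its children roots; then do ranked links while two roots have equal rank; then do unranked links until one root remains. delete-min($h$) performs delete on the item in the root. *)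

(* Defs.v *)
From Stdlib Require Import Relations.
From mathcomp Require Import all_boot all_order finmap.

Set Implicit Arguments.
Unset Strict Implicit.
Unset Printing Implicit Defensive.

Import Order.TTheory.
Local Open Scope fset_scope.
Local Open Scope fmap_scope.

Definition address := nat.
Definition handle := nat.

(* A hollow node remembers which kind of operation made it hollow; only the
   statement of the rank invariant looks at this. *)
Inductive occupancy (E : Type) :=
  | Full of E
  | HollowByDecreaseKey
  | HollowByDelete.

Arguments HollowByDecreaseKey {E}.
Arguments HollowByDelete {E}.

(* [parent x] is [None] if [x] is a root; it is [Some (u, b)] if [x] is a child
   of the node at address [u], a ranked child if [b] and an unranked one
   otherwise. *)
Record node (d : Order.disp_t) (K : orderType d) (E : Type) := Node {
  occ : occupancy E;
  key : K;
  rank : nat;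
  parent : option (address * bool)
}.

Definition forest (d : Order.disp_t) (K : orderType d) (E : Type) :=
  {fmap address -> node K E}.

(* [hroot] is the pointer by which the heap is accessed, [None] for an empty
   heap. *)
Record heap (d : Order.disp_t) (K : orderType d) (E : Type) := Heap {
  hroot : option address;
  hnodes : forest K E
}.

(* All the heaps in existence. *)
Definition world (d : Order.disp_t) (K : orderType d) (E : Type) :=
  {fmap handle -> heap K E}.

Inductive operation (d : Order.disp_t) (K : orderType d) (E : Type) :=
  | MakeHeap
  | FindMin of handle
  | Insert of E & K & handle
  | DeleteMin of handle
  | Meld of handle & handle
  | DecreaseKey of E & K & handle
  | Delete of E & handle.

Arguments MakeHeap {d K E}.
Arguments FindMin {d K E}.
Arguments Insert {d K E}.
Arguments DeleteMin {d K E}.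
Arguments Meld {d K E}.
Arguments DecreaseKey {d K E}.
Arguments Delete {d K E}.

(* [ReturnItem None] is the answer "null". *)
Inductive result (E : Type) :=
  | ReturnItem of option E
  | ReturnHeap of handle.

Arguments ReturnHeap {E}.

(* The heaps destroyed by an operation; [FindMin] is a query. *)
Definition consumed (d : Order.disp_t) (K : orderType d) (E : Type)
    (op : operation K E) : {fset handle} :=
  match op with
  | MakeHeap | FindMin _ => fset0
  | Insert _ _ h | DeleteMin h | DecreaseKey _ _ h | Delete _ h => [fset h]
  | Meld h1 h2 => [fset h1; h2]
  end.

Section Specification.

Variables (d : Order.disp_t) (K : orderType d) (E : choiceType).
Implicit Types (A : {fmap handle -> {fmap E -> K}}) (m : {fmap E -> K}).

Definition legal A (op : operation K E) : Prop :=
  match op with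
  | MakeHeap => True
  | FindMin h => h \in domf A
  | Insert e _ h =>
      h \in domf A /\ forall h' m, A.[? h'] = Some m -> e \notin domf m
  | DeleteMin h => exists2 m, A.[? h] = Some m & domf m != fset0
  | Meld h1 h2 =>
      h1 != h2 /\ exists m1 m2, [/\ A.[? h1] = Some m1, A.[? h2] = Some m2
                                 & [disjoint domf m1 & domf m2]%fset]
  | DecreaseKey e k h =>
      exists m k0, [/\ A.[? h] = Some m, m.[? e] = Some k0 & (k < k0)%O]
  | Delete e h => exists2 m, A.[? h] = Some m & e \in domf m
  end.

Definition is_min m (x : option E) : Prop :=
  match x with
  | None => domf m = fset0
  | Some e => exists2 k, m.[? e] = Some k &
                forall e' k', m.[? e'] = Some k' -> (k <= k')%O
  end.

(* [fm h] is the item that find-min(h) returns, to which the specification of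
   delete-min refers. A returned heap gets a handle [h'] not used by any of the
   remaining heaps. *)
Inductive spec (fm : handle -> option E) A :
    operation K E -> result E -> {fmap handle -> {fmap E -> K}} -> Prop :=
  | spec_make_heap h' :
      h' \notin domf A ->
      spec fm A MakeHeap (ReturnHeap h') A.[h' <- [fmap]]
  | spec_find_min h m x :
      A.[? h] = Some m -> is_min m x -> fm h = x ->
      spec fm A (FindMin h) (ReturnItem x) A
  | spec_insert e k h m h' :
      A.[? h] = Some m -> h' \notin domf A.[~ h] ->
      spec fm A (Insert e k h) (ReturnHeap h') A.[~ h].[h' <- m.[e <- k]]
  | spec_delete_min h m e h' :
      A.[? h] = Some m -> is_min m (Some e) -> fm h = Some e ->
      h' \notin domf A.[~ h] ->
      spec fm A (DeleteMin h) (ReturnHeap h') A.[~ h].[h' <- m.[~ e]]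
  | spec_meld h1 h2 m1 m2 h' :
      A.[? h1] = Some m1 -> A.[? h2] = Some m2 ->
      h' \notin domf A.[\ [fset h1; h2]] ->
      spec fm A (Meld h1 h2) (ReturnHeap h')
           A.[\ [fset h1; h2]].[h' <- m1 + m2]
  | spec_decrease_key e k h m h' :
      A.[? h] = Some m -> h' \notin domf A.[~ h] ->
      spec fm A (DecreaseKey e k h) (ReturnHeap h') A.[~ h].[h' <- m.[e <- k]]
  | spec_delete e h m h' :
      A.[? h] = Some m -> h' \notin domf A.[~ h] ->
      spec fm A (Delete e h) (ReturnHeap h') A.[~ h].[h' <- m.[~ e]].

End Specification.

Section HollowHeaps.

Variables (d : Order.disp_t) (K : orderType d) (E : choiceType).
Implicit Types (F : forest K E) (H : heap K E) (W : world K E).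
Implicit Types (x y : node K E) (u v w l : address).

Definition is_full x : bool := if occ x is Full _ then true else false.

Definition set_occ (c : occupancy E) x := Node c (key x) (rank x) (parent x).
Definition set_key (k : K) x := Node (occ x) k (rank x) (parent x).
Definition set_parent p x := Node (occ x) (key x) (rank x) p.
Definition incr_rank x := Node (occ x) (key x) (rank x).+1 (parent x).

Definition nodes F : seq (node K E) := [seq F u | u : domf F].

Definition map_nodes (f : node K E -> node K E) F : forest K E :=
  [fmap u : domf F => f (F u)].

Definition is_root F u : bool :=
  if F.[? u] is Some x then parent x == None else false.

Definition roots F : {fset address} := [fset u in domf F | is_root F u].

Definition arc F v w : bool :=
  (v \in domf F) &&
  if F.[? w] is Some y then omap fst (parent y) == Some v else false.

Definition full_at F u : bool :=
  if F.[? u] is Some x then is_full x else false.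

Definition find_min H : option E :=
  if hroot H is Some u then
    if (hnodes H).[? u] is Some x then
      if occ x is Full e then Some e else None
    else None
  else None.

(* [link b F w l F'] : [w] wins and [l] loses a link, ranked iff [b]. *)
Inductive link (b : bool) F w l : forest K E -> Prop :=
  | Link x y :
      F.[? w] = Some x -> F.[? l] = Some y -> w != l ->
      is_root F w -> is_root F l -> is_full x -> is_full y ->
      (key x <= key y)%O -> (b -> rank x = rank y) ->
      link b F w l F.[w <- if b then incr_rank x else x]
                    .[l <- set_parent (Some (w, b)) y].

Definition destroy u F : forest K E :=
  (map_nodes (fun x => if omap fst (parent x) == Some u
                       then set_parent None x else x) F).[~ u].

(* Effect of decrease-key(e, k) on the non-root node [x] at address [u], with
   new node [v], before the final meld; [S] selects the unranked children that
   are moved. Truncated subtraction gives max {0, rank x - 2}. *)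
Definition moved_child u r (S : {fset address}) F w : bool :=
  if F.[? w] is Some y then
    (parent y == Some (u, true)) && (rank y < r) ||
    (parent y == Some (u, false)) && (w \in S)
  else false.

Definition split_node e k u x v (S : {fset address}) F : forest K E :=
  [fmap w : domf F =>
     if moved_child u (rank x - 2) S F (val w)
     then set_parent (omap (fun p => (v, p.2)) (parent (F w))) (F w)
     else F w]
  .[u <- set_occ HollowByDecreaseKey x]
  .[v <- Node (Full e) k (rank x - 2) None].

(* An operation that returns a heap is carried out in successive phases.
   [Melding F o1 o2] : it remains to meld the trees of [F] with roots [o1] and
   [o2] ([None] standing for an empty tree).
   [Deleting F] : the loop of a deletion at a root is running on [F]. *)
Inductive phase :=
  | Melding of forest K E & option address & option address
  | Deleting of forest K E
  | Done of heap K E.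

Definition phase_forest (P : phase) : forest K E :=
  match P with Melding F _ _ | Deleting F => F | Done H => hnodes H end.

Definition no_hollow_root F : Prop := forall u, is_root F u -> full_at F u.

Definition equal_rank_roots F u v : Prop :=
  [/\ u != v, is_root F u, is_root F v
    & omap (@rank _ _ _) F.[? u] = omap (@rank _ _ _) F.[? v]].

Inductive step : phase -> phase -> Prop :=
  | step_meld_empty_l F o : step (Melding F None o) (Done (Heap o F))
  | step_meld_empty_r F o : step (Melding F o None) (Done (Heap o F))
  | step_meld_link_l F u v F' :
      link false F u v F' ->
      step (Melding F (Some u) (Some v)) (Done (Heap (Some u) F'))
  | step_meld_link_r F u v F' :
      link false F v u F' ->
      step (Melding F (Some u) (Some v)) (Done (Heap (Some v) F'))
  | step_destroy F u :
      is_root F u -> ~~ full_at F u ->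
      step (Deleting F) (Deleting (destroy u F))
  | step_ranked_link F w l F' :
      no_hollow_root F -> link true F w l F' ->
      step (Deleting F) (Deleting F')
  | step_unranked_link F w l F' :
      no_hollow_root F -> (forall u v, ~ equal_rank_roots F u v) ->
      link false F w l F' ->
      step (Deleting F) (Deleting F')
  | step_no_root F :
      roots F = fset0 -> step (Deleting F) (Done (Heap None F))
  | step_one_root F u :
      roots F = [fset u] -> full_at F u ->
      step (Deleting F) (Done (Heap (Some u) F)).

Definition steps : phase -> phase -> Prop := clos_refl_trans_1n phase step.

Definition fresh W v : Prop :=
  forall h H, W.[? h] = Some H -> v \notin domf (hnodes H).

Inductive start W : operation K E -> phase -> Prop :=
  | start_make_heap : start W MakeHeap (Done (Heap None [fmap]))
  | start_insert e k h H v :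
      W.[? h] = Some H -> fresh W v ->
      start W (Insert e k h)
        (Melding (hnodes H).[v <- Node (Full e) k 0 None] (Some v) (hroot H))
  | start_meld h1 h2 H1 H2 :
      W.[? h1] = Some H1 -> W.[? h2] = Some H2 ->
      start W (Meld h1 h2)
        (Melding (hnodes H1 + hnodes H2) (hroot H1) (hroot H2))
  | start_decrease_key_root e k h H u x :
      W.[? h] = Some H -> (hnodes H).[? u] = Some x -> occ x = Full e ->
      hroot H = Some u ->
      start W (DecreaseKey e k h)
        (Done (Heap (hroot H) (hnodes H).[u <- set_key k x]))
  | start_decrease_key_nonroot e k h H u x v S :
      W.[? h] = Some H -> (hnodes H).[? u] = Some x -> occ x = Full e ->
      hroot H <> Some u -> fresh W v ->
      start W (DecreaseKey e k h)
        (Melding (split_node e k u x v S (hnodes H)) (Some v) (hroot H))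
  | start_delete_root e h H u x :
      W.[? h] = Some H -> (hnodes H).[? u] = Some x -> occ x = Full e ->
      hroot H = Some u ->
      start W (Delete e h)
        (Deleting (hnodes H).[u <- set_occ HollowByDelete x])
  | start_delete_nonroot e h H u x :
      W.[? h] = Some H -> (hnodes H).[? u] = Some x -> occ x = Full e ->
      hroot H <> Some u ->
      start W (Delete e h)
        (Done (Heap (hroot H) (hnodes H).[u <- set_occ HollowByDelete x]))
  | start_delete_min h H e P :
      W.[? h] = Some H -> find_min H = Some e -> start W (Delete e h) P ->
      start W (DeleteMin h) P.

Definition during W op (Q : phase) : Prop :=
  exists2 P, start W op P & steps P Q.

Inductive exec W : operation K E -> result E -> world K E -> Prop :=
  | exec_query h H :
      W.[? h] = Some H -> exec W (FindMin h) (ReturnItem (find_min H)) W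
  | exec_update op H h' :
      during W op (Done H) -> h' \notin domf W.[\ consumed op] ->
      exec W op (ReturnHeap h') W.[\ consumed op].[h' <- H].

(* If an item were held by several nodes, one of its keys would be kept; the
   second half of [separated] excludes this. *)
Definition contents H : {fmap E -> K} :=
  foldr (fun x m => if occ x is Full e then m.[e <- key x] else m) [fmap]
        (nodes (hnodes H)).

Definition abstraction W : {fmap handle -> {fmap E -> K}} :=
  [fmap h : domf W => contents (W h)].

Definition returned_min W (h : handle) : option E :=
  if W.[? h] is Some H then find_min H else None.

Inductive reachable : world K E -> Prop :=
  | reachable_init : reachable [fmap]
  | reachable_step W op r W' :
      reachable W -> legal (abstraction W) op -> exec W op r W' ->
      reachable W'.

Definition heap_ordered F : Prop :=
  forall v w x y, F.[? v] = Some x -> F.[? w] = Some y -> arc F v w ->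
    (key x <= key y)%O.

(* A node has at most one parent by construction, so it is enough that every
   node be reachable from the parentless node [u]. *)
Definition rooted_tree F u : Prop :=
  is_root F u /\
  forall w, w \in domf F -> exists2 p, path (arc F) u p & last u p = w.

Definition heap_ordered_tree H : Prop :=
  match hroot H with
  | None => domf (hnodes H) = fset0
  | Some u => [/\ rooted_tree (hnodes H) u, heap_ordered (hnodes H)
                & full_at (hnodes H) u]
  end.

Definition ranked_child_ranks F u : seq nat :=
  [seq rank y | y <- nodes F & parent y == Some (u, true)].

Definition rank_invariant F : Prop :=
  forall u x, F.[? u] = Some x ->
    if (2 < rank x) && (if occ x is HollowByDecreaseKey then true else false)
    then perm_eq (ranked_child_ranks F u) [:: rank x - 2; rank x - 1]
    else perm_eq (ranked_child_ranks F u) (iota 0 (rank x)).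

Definition holds W h u e : Prop :=
  exists H x, [/\ W.[? h] = Some H, (hnodes H).[? u] = Some x & occ x = Full e].

Definition separated W : Prop :=
  (forall h1 h2 H1 H2 u, W.[? h1] = Some H1 -> W.[? h2] = Some H2 ->
     u \in domf (hnodes H1) -> u \in domf (hnodes H2) -> h1 = h2) /\
  (forall h1 h2 u1 u2 e, holds W h1 u1 e -> holds W h2 u2 e ->
     h1 = h2 /\ u1 = u2).

(* No execution from [Q] is infinite or gets stuck. *)
Definition terminates (Q : phase) : Prop :=
  Acc (fun Q2 Q1 => step Q1 Q2) Q /\
  forall Q', steps Q Q' -> (exists H, Q' = Done H) \/ exists Q'', step Q' Q''.

End HollowHeaps.

(* Main.v *)
(* Idea: every intermediate state of an operation is a forest in which each node
   is connected to a root, arcs are heap-ordered, no item is held twice, and the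
   ranked children of a node u of rank r have pairwise distinct ranks, namely
   those below r, or only those in [r-2, r) if u was split by a decrease-key.
   A ranked link adds to a full winner of rank r exactly the missing child of
   rank r; a decrease-key at u moves exactly the ranks below r-2 to the new node
   of rank r-2; destroying a root changes the children of no other node. Full
   nodes never leave during the phases of an operation, so its effect on the
   items is settled at its start, and heap order makes the unique full root a
   minimum. *)
Require Import Defs.
From Stdlib Require Import Relations.
From mathcomp Require Import all_boot all_order finmap.

Set Implicit Arguments.
Unset Strict Implicit.
Unset Printing Implicit Defensive.

Import Order.TTheory.
Local Open Scope fset_scope.
Local Open Scope fmap_scope.

(** The ranked children of a node are known only through the parent fields of other nodes. The rank
    invariant is therefore kept as two pointwise facts: siblings that are ranked children have
    distinct ranks, and the ranks that occur are characterised by inequalities. They become lists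
    only at the end. This view is safe because every parent field leads to an existing node: a fresh
    address then has no children that could be attributed to a new node.

    Ranks up to 2 need no case of their own in a split. Truncation gives [r - 2 = 0], so no ranked
    child moves, and the bound [r <= i + 2] holds for every [i]. A node is split at most once, since
    it must be full before and is hollow afterwards; links and splits thus always meet a node whose
    ranked children have all the smaller ranks.

    The induction runs over whole worlds, since freshness of addresses and legality of operations
    speak of all heaps. What keeps the heaps apart is that a returned heap uses only addresses of
    consumed heaps or new ones, and only items of consumed heaps or items that were in no heap. *)

Section Forests.

Variables (d : Order.disp_t) (K : orderType d) (E : choiceType).
Implicit Types (F G : forest K E) (H : heap K E) (W : world K E).
Implicit Types (x y : node K E) (u v w l z t : address).

(** * Lookups, roots, and the invariant of a forest *)

Lemma fnd_map_nodes (f : node K E -> node K E) F u :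
  (map_nodes f F).[? u] = omap f F.[? u].
Proof.
case: (fndP (map_nodes f F) u) => [uF|uNF].
  by rewrite ffunE (@in_fnd _ _ F u uF).
by rewrite not_fnd.
Qed.

Lemma fnd_destroy u F z :
  (destroy u F).[? z] =
  if z == u then None
  else omap (fun x => if omap fst (parent x) == Some u
                      then set_parent None x else x) F.[? z].
Proof. by rewrite /destroy fnd_rem1 fnd_map_nodes eq_sym; case: eqP. Qed.

Lemma fnd_split_node e k u x v S F z :
  (split_node e k u x v S F).[? z] =
  if z == v then Some (Node (Full e) k (rank x - 2) None)
  else if z == u then Some (set_occ HollowByDecreaseKey x)
  else if moved_child u (rank x - 2) S F z
  then omap (fun y => set_parent (omap (fun p => (v, p.2)) (parent y)) y) F.[? z]
  else F.[? z].
Proof.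
rewrite /split_node !fnd_set; case: eqP => // _; case: eqP => // _.
set G := FinMap _.
case: (fndP G z) => [zF|zNF]; last by rewrite not_fnd //= if_same.
by rewrite ffunE /= (@in_fnd _ _ F z zF); case: ifP.
Qed.

Lemma is_rootP F u :
  reflect (exists2 x, F.[? u] = Some x & parent x = None) (is_root F u).
Proof.
rewrite /is_root; case: F.[? u] => [x|]; last by constructor => -[].
by apply: (iffP eqP) => [|[_ [<-]]//]; exists x.
Qed.

Lemma in_roots F u : (u \in Defs.roots F) = is_root F u.
Proof.
by rewrite !inE /=; case: fndP => // uNF; rewrite /is_root not_fnd.
Qed.

Lemma in_domfP (T : choiceType) (V : Type) (f : {fmap T -> V}) a :
  reflect (exists b, f.[? a] = Some b) (a \in domf f).
Proof.
by rewrite -fndSome; case: f.[? a] => [b|]; constructor; [exists b|case].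
Qed.

Lemma full_atP F u :
  reflect (exists2 x, F.[? u] = Some x & is_full x) (full_at F u).
Proof.
rewrite /full_at; case: F.[? u] => [x|]; last by constructor => -[].
by apply: (iffP idP) => [|[_ [<-]]//]; exists x.
Qed.

Lemma is_fullP x : reflect (exists e, occ x = Full e) (is_full x).
Proof.
by rewrite /is_full; case: (occ x) => [e||]; constructor; [exists e|case|case].
Qed.

(* Parents being unique, this excludes cycles as well as dangling parents. *)
Inductive grounded F : address -> Prop :=
  | grounded_root u : is_root F u -> grounded F u
  | grounded_child u v b x :
      F.[? u] = Some x -> parent x = Some (v, b) -> grounded F v ->
      grounded F u.

Definition ranked_child F u r w : Prop :=
  exists y, [/\ F.[? w] = Some y, parent y = Some (u, true) & rank y = r].

Definition split_by_decrease_key x : bool :=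
  if occ x is HollowByDecreaseKey then true else false.

(** Relational counterpart of [contents], available for any intermediate forest; [contentsP] relates
    the two. *)
Definition item F (e : E) (k : K) : Prop :=
  exists u x, [/\ F.[? u] = Some x, occ x = Full e & key x = k].

(* [wf_rank] also covers nodes of rank at most 2 that
   were split: for them the second conjunct is vacuous. *)
Record wf F : Prop := Wf {
  wf_grounded : forall u x, F.[? u] = Some x -> grounded F u;
  wf_order : forall u v b x y, F.[? u] = Some x -> F.[? v] = Some y ->
    parent y = Some (u, b) -> (key x <= key y)%O;
  wf_rank_uniq : forall u r w z,
    ranked_child F u r w -> ranked_child F u r z -> w = z;
  wf_rank : forall u x r, F.[? u] = Some x ->
    (exists w, ranked_child F u r w) <->
    r < rank x /\ (split_by_decrease_key x -> rank x <= r + 2);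
  wf_items : forall u v x y e, F.[? u] = Some x -> F.[? v] = Some y ->
    occ x = Full e -> occ y = Full e -> u = v
}.

(** Ranked links and splits act on full nodes, so the exceptional case of [wf_rank] never applies to
    the node they start from. *)
Lemma full_not_split x : is_full x -> split_by_decrease_key x = false.
Proof. by rewrite /is_full /split_by_decrease_key; case: (occ x). Qed.

Lemma grounded_fnd F u : grounded F u -> exists x, F.[? u] = Some x.
Proof. by case=> {}u => [/is_rootP[x]|v b x ]; exists x. Qed.

Lemma grounded_parent F u x v b :
  grounded F u -> F.[? u] = Some x -> parent x = Some (v, b) -> grounded F v.
Proof.
case=> {}u => [/is_rootP[y Fu py]|{}w c y Fu py gw]; rewrite Fu => -[<-].
  by rewrite py.
by rewrite py => -[<- _].
Qed.

(** A node that is its own parent could be grounded only through itself, which no finite derivation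
    allows. A split relies on this: the node being split is not among its own children. *)
Lemma grounded_irrefl F u x b :
  grounded F u -> F.[? u] = Some x -> parent x <> Some (u, b).
Proof.
move=> gu; elim: gu x b => {}u => [/is_rootP[y Fu py]|v c y Fu py gv IH] x b.
  by rewrite Fu => -[<-]; rewrite py.
rewrite Fu => -[<-]; rewrite py => -[vu cb]; subst v.
by apply: (IH y c).
Qed.

Lemma wf_parent F u x v b : wf F -> F.[? u] = Some x ->
  parent x = Some (v, b) -> exists y, F.[? v] = Some y.
Proof.
move=> wfF Fu px; apply: grounded_fnd.
exact: (grounded_parent (wf_grounded wfF Fu) Fu px).
Qed.

(** * Links *)

Lemma fnd_link b F w l F' x y :
  F' = F.[w <- if b then incr_rank x else x].[l <- set_parent (Some (w, b)) y] ->
  forall z, F'.[? z] = if z == l then Some (set_parent (Some (w, b)) y)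
                       else if z == w then Some (if b then incr_rank x else x)
                       else F.[? z].
Proof. by move=> -> z; rewrite !fnd_set. Qed.

Lemma is_root_link b F w l F' z : link b F w l F' ->
  is_root F' z = (z != l) && is_root F z.
Proof.
case=> x y Fw Fl wl rw rl _ _ _ _; rewrite {1}/is_root !fnd_set.
case: eqP => //= _; case: eqP => [->|_]; last by rewrite /is_root.
by rewrite rw; move: rw; rewrite /is_root Fw; case: (b).
Qed.

(** Only [w] can change rank, and as a root it is nobody's child; only [l] changes parent, and it
    had none. *)
Lemma ranked_child_link b F w l F' u r z y : link b F w l F' ->
  F.[? l] = Some y ->
  ranked_child F' u r z <->
  ranked_child F u r z \/ [/\ b, u = w, z = l & rank y = r].
Proof.
case=> x y' Fw Fl wl rw rl _ _ _ _; rewrite Fl => -[<-] {y}.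
move: rw rl; rewrite /is_root Fw Fl => /eqP px /eqP py.
split.
  case=> n; rewrite !fnd_set; case: eqP => [->|zl].
    by case=> -[<-] /= [-> ->] <-; right.
  case: eqP => [->|zw] [Fz pz rz]; last by left; exists n.
  by move: Fz pz => [<-]; case: (b); rewrite /= px.
case=> [[n [Fz pz rz]]|[bt -> -> ry]].
  exists n; split=> //; rewrite !fnd_set; case: eqP => [zl|_].
    by move: Fz pz; rewrite zl Fl => -[<-]; rewrite py.
  case: eqP => [zw|//].
  by move: Fz pz; rewrite zw Fw => -[<-]; rewrite px.
exists (set_parent (Some (w, b)) y'); split=> //; last by rewrite bt.
by rewrite fnd_set eqxx.
Qed.

Lemma item_link b F w l F' e k : link b F w l F' ->
  item F' e k <-> item F e k.
Proof.
case=> x y Fw Fl wl _ _ _ _ _ _; split=> -[z [n [Fz oz kz]]].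
  move: Fz; rewrite !fnd_set; case: eqP => [_|_].
    by case=> nE; exists l, y; split=> //; [rewrite -oz -nE|rewrite -kz -nE].
  case: eqP => [_|_]; last by move=> Fz; exists z, n.
  by case=> nE; exists w, x; split=> //; [rewrite -oz -nE|rewrite -kz -nE];
     case: (b).
case zl: (z == l).
  exists l, (set_parent (Some (w, b)) y); rewrite fnd_set eqxx; split=> //.
    by rewrite -oz; move: Fz; rewrite (eqP zl) Fl => -[<-].
  by rewrite -kz; move: Fz; rewrite (eqP zl) Fl => -[<-].
case zw: (z == w).
  exists w, (if b then incr_rank x else x).
  rewrite !fnd_set (negPf wl) eqxx.
  by move: Fz; rewrite (eqP zw) Fw => -[?]; subst n; split=> //; case: (b).
by exists z, n; rewrite !fnd_set zl zw.
Qed.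

Lemma wf_link b F w l F' : wf F -> link b F w l F' -> wf F'.
Proof.
move=> wfF L; have rc := ranked_child_link _ _ _ L; have rt := is_root_link _ L.
case: L rc rt => x y Fw Fl wl rw rl fx fy kxy rk rc rt.
have {rc} rc u r z := rc u r z _ Fl.
clear F'; set F' := F.[_ <- _].[_ <- _] in rc rt *.
have FE := fnd_link (erefl F'); rewrite -/F' in FE.
move: (rw) (rl); rewrite /is_root Fw Fl => /eqP px /eqP py.
have old z n : F'.[? z] = Some n -> exists n0,
    [/\ F.[? z] = Some n0, key n = key n0, occ n = occ n0,
        rank n = (rank n0 + (b && (z == w)))%N &
        parent n = if z == l then Some (w, b) else parent n0].
  rewrite FE; case: eqP => [->|zl].
    by case=> <-; exists y; rewrite /= eq_sym (negPf wl) andbF addn0.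
  case: eqP => [->|zw]; last by move=> ?; exists n; rewrite andbF addn0.
  by case=> <-; exists x; case: (b); rewrite /= ?addn1 ?addn0.
have gw : grounded F' w by apply: grounded_root; rewrite rt wl.
(* A derivation that ended at the root [l] is extended by the new arc from [w], which is still a
   root. *)
have ground z : grounded F z -> grounded F' z.
  elim=> {}z => [rz|v c n Fz pz gv IH].
    case zl: (z == l); last by apply: grounded_root; rewrite rt zl.
    apply: (@grounded_child _ _ w b (set_parent (Some (w, b)) y)) => //.
    by rewrite FE zl.
  apply: (@grounded_child _ _ v c n) => //.
  rewrite FE; case: eqP => [zl|_].
    by move: Fz pz; rewrite zl Fl => -[<-]; rewrite py.
  case: eqP => [zw|//].
  by move: Fz pz; rewrite zw Fw => -[<-]; rewrite px.
split.
- by move=> u n /old[n0 [Fu _ _ _ _]]; apply: ground; apply: wf_grounded Fu.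
- move=> u v c n m /old[n0 [Fu -> _ _ _]] /old[m0 [Fv -> _ _ ->]].
  case: eqP => [vl [wu _]|_ pm]; last exact: (wf_order wfF Fu Fv pm).
  move: Fu Fv; rewrite -wu vl Fw Fl => -[<-] [<-]; exact: kxy.
(* The ranked children of [w] have ranks below [rank x], so the rank that [l] brings to a ranked
   link is new. *)
- have noold r z : b -> rank y = r -> ranked_child F w r z -> False.
    move=> bt ry rz; have [+ _] := wf_rank wfF r Fw.
    by case; [exists z|rewrite -ry (rk bt) ltnn].
  move=> u r v z /rc[rv|[bt uw -> ry]] /rc[rz|[bt' uw' -> ry']] //.
  + exact: (wf_rank_uniq wfF rv rz).
  + by rewrite uw' in rv; case: (noold _ _ bt' ry' rv).
  + by rewrite uw in rz; case: (noold _ _ bt ry rz).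
- move=> u n r /old[n0 [Fu _ on rn _]].
  have rF := wf_rank wfF r Fu.
  have -> : split_by_decrease_key n = split_by_decrease_key n0.
    by rewrite /split_by_decrease_key on.
  transitivity ((exists v, ranked_child F u r v) \/ [/\ b, u = w & rank y = r]).
    split=> [[v /rc[rv|[]]]|[[v rv]|[bt uw ry]]]; try by [right|left; exists v].
      by exists v; apply/rc; left.
    by exists l; apply/rc; right.
  case uw: (u == w); last first.
    rewrite rn uw andbF addn0.
    split=> [[/rF//|[_ uw']]|/rF]; last by left.
    by rewrite uw' eqxx in uw.
  move: Fu rF; rewrite rn uw (eqP uw) Fw => -[<-]; rewrite full_not_split // => rF.
  rewrite andbT; split=> [[/rF[rx _]|[bt _ <-]]|[rx _]].
  + by rewrite ltn_addr.
  + by rewrite bt addn1 -(rk bt).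
  move: rx; case: (b) rk => [/(_ isT) rxy|_]; rewrite ?addn1 ?addn0.
    (* The winner's rank has become [rank x + 1]: the top rank [rank x] is supplied by the loser,
       and the ranks below it by the old children. *)
    rewrite ltnS leq_eqVlt => /orP[/eqP->|rx]; first by right.
    by left; apply/rF.
  by move=> rx; left; apply/rF.
- move=> u v n m e /old[n0 [Fu _ -> _ _]] /old[m0 [Fv _ -> _ _]].
  exact: (wf_items wfF Fu Fv).
Qed.

(** * Changing one node in place *)

Lemma is_root_update F u x x' z : F.[? u] = Some x -> parent x' = parent x ->
  is_root F.[u <- x'] z = is_root F z.
Proof.
move=> Fu px; rewrite /is_root fnd_set; case: eqP => [->|//].
by rewrite Fu px.
Qed.

(** Serves [set_key] at a root and [set_occ HollowByDelete] anywhere. Lowering a key preserves the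
    order towards children; towards a parent, either the key is unchanged or there is no parent.
    Neither the old node nor the new one is split, so [wf_rank] asks the same of both. *)
Lemma wf_update F u x x' :
  wf F -> F.[? u] = Some x -> is_full x ->
  parent x' = parent x -> rank x' = rank x -> ~~ split_by_decrease_key x' ->
  (key x' <= key x)%O -> (key x' = key x \/ parent x = None) ->
  (forall e, occ x' = Full e -> occ x = Full e) ->
  wf F.[u <- x'].
Proof.
move=> wfF Fu fx px rx sx kx kpx ox.
have old z n : F.[u <- x'].[? z] = Some n -> exists n0,
    [/\ F.[? z] = Some n0, (key n <= key n0)%O,
        key n = key n0 \/ parent n = None,
        rank n = rank n0 /\ parent n = parent n0 &
        split_by_decrease_key n = split_by_decrease_key n0 /\
        forall e, occ n = Full e -> occ n0 = Full e].
  rewrite fnd_set; case: eqP => [-> [<-]|_ Fz]; last by exists n; split=> //; left.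
  exists x; split=> //; first by rewrite px.
  by split=> //; rewrite (full_not_split fx) (negPf sx).
have new z n0 : F.[? z] = Some n0 -> exists n,
    [/\ F.[u <- x'].[? z] = Some n, parent n = parent n0 & rank n = rank n0].
  rewrite fnd_set; case: eqP => [->|_ Fz]; last by exists n0.
  by rewrite Fu => -[<-]; exists x'.
have rc t r z : ranked_child F.[u <- x'] t r z <-> ranked_child F t r z.
  split=> -[n [Fz pz rz]].
    by have [n0 [Fz0 _ _ [rn pn] _]] := old _ _ Fz; exists n0; rewrite -rn -pn.
  by have [n0 [Fz0 pn rn]] := new _ _ Fz; exists n0; rewrite rn pn.
have ground z : grounded F z -> grounded F.[u <- x'] z.
  elim=> {}z => [rz|v b n Fz pz _ IH].
    by apply: grounded_root; rewrite (is_root_update _ Fu).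
  have [n' [Fz' pn _]] := new _ _ Fz.
  by apply: (grounded_child Fz' _ IH); rewrite pn; apply: pz.
split.
- by move=> z n /old[n0 [Fz _ _ _ _]]; apply/ground/(wf_grounded wfF Fz).
- move=> z v b n m /old[n0 [Fz kn _ _ _]] /old[m0 [Fv _ km [_ pm] _]] pmz.
  case: km => [->|]; last by rewrite pmz.
  by apply: le_trans kn (wf_order wfF Fz Fv _); rewrite -pm; apply: pmz.
- by move=> t r v z /rc rv /rc; apply: (wf_rank_uniq wfF).
- move=> t n r /old[n0 [Ft _ _ [-> _] [-> _]]].
  rewrite -(wf_rank wfF r Ft); split=> -[z /rc rz]; exists z => //.
- move=> v z n m e /old[n0 [Fv _ _ _ [_ on]]] /old[m0 [Fz _ _ _ [_ om]]] /on + /om.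
  exact: (wf_items wfF Fv Fz).
Qed.

(** * Disjoint unions, the empty forest and one-node forests *)

Lemma fnd_cat_disjoint (T : choiceType) (V : Type) (f g : {fmap T -> V}) a b :
  [disjoint domf f & domf g]%fset ->
  (f + g).[? a] = Some b <-> f.[? a] = Some b \/ g.[? a] = Some b.
Proof.
move=> /fdisjointP dfg; rewrite fnd_cat; case: ifPn => ag; split.
- by right.
- case=> // fa; have /dfg : a \in domf f by apply/in_domfP; exists b.
  by rewrite ag.
- by left.
- by case=> //; rewrite not_fnd.
Qed.

Lemma grounded_sub F G u :
  (forall z x, F.[? z] = Some x -> G.[? z] = Some x) ->
  grounded F u -> grounded G u.
Proof.
move=> FG; elim=> {}u => [/is_rootP[x Fu px]|v b x Fu px _ IH].
  by apply/grounded_root/is_rootP; exists x => //; apply: FG.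
by apply: (grounded_child (FG _ _ Fu) px IH).
Qed.

Lemma is_root_cat F G u : [disjoint domf F & domf G]%fset ->
  is_root (F + G)%fmap u <-> is_root F u \/ is_root G u.
Proof.
move=> dFG; split=> [/is_rootP[x /(fnd_cat_disjoint _ _ dFG)[] Fu px]|].
- by left; apply/is_rootP; exists x.
- by right; apply/is_rootP; exists x.
- by case=> /is_rootP[x Fu px]; apply/is_rootP; exists x => //;
    apply/(fnd_cat_disjoint _ _ dFG); [left|right].
Qed.

Lemma item_cat F G e k : [disjoint domf F & domf G]%fset ->
  item (F + G)%fmap e k <-> item F e k \/ item G e k.
Proof.
move=> dFG; split=> [[u [x [/(fnd_cat_disjoint _ _ dFG)[] Fu oe kx]]]|].
- by left; exists u, x.
- by right; exists u, x.
- by case=> -[u [x [Fu oe kx]]]; exists u, x; split=> //;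
    apply/(fnd_cat_disjoint _ _ dFG); [left|right].
Qed.

(** No arc joins the two forests: a parent field leads to a node of the same forest, and the domains
    are disjoint. Each clause is inherited separately from each side, except the one on items, which
    needs the last hypothesis. *)
Lemma wf_cat F G : wf F -> wf G -> [disjoint domf F & domf G]%fset ->
  (forall e k k', item F e k -> item G e k' -> False) -> wf (F + G).
Proof.
move=> wfF wfG dFG iFG.
have lk z x := fnd_cat_disjoint z x dFG.
have rc t r z : ranked_child (F + G)%fmap t r z <->
    ranked_child F t r z \/ ranked_child G t r z.
  split=> [[n [/lk[] Fz pz rz]]|]; try by [left; exists n|right; exists n].
  by case=> -[n [Fz pz rz]]; exists n; split=> //; apply/lk; [left|right].
have nodup z x y : F.[? z] = Some x -> G.[? z] = Some y -> False.
  move=> Fz Gz; have /(fdisjointP dFG) : z \in domf F by apply/in_domfP; exists x.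
  by case/negP; apply/in_domfP; exists y.
have noparent1 z x t b y : F.[? z] = Some x -> parent x = Some (t, b) ->
    G.[? t] = Some y -> False.
  by move=> Fz pz; have [n Ft] := wf_parent wfF Fz pz; apply: nodup Ft.
have noparent2 z x t b y : G.[? z] = Some x -> parent x = Some (t, b) ->
    F.[? t] = Some y -> False.
  by move=> Gz pz Ft; have [n] := wf_parent wfG Gz pz; apply: nodup Ft.
split.
- move=> u x /lk[Fu|Gu].
    by apply: grounded_sub (wf_grounded wfF Fu) => z n Fz; apply/lk; left.
  by apply: grounded_sub (wf_grounded wfG Gu) => z n Fz; apply/lk; right.
- move=> u v b x y /lk[]Fu /lk[]Fv py.
  + exact: (wf_order wfF Fu Fv py).
  + by case: (noparent2 _ _ _ _ _ Fv py Fu).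
  + by case: (noparent1 _ _ _ _ _ Fv py Fu).
  + exact: (wf_order wfG Fu Fv py).
- move=> u r v z /rc[]rv /rc[]rz.
  + exact: (wf_rank_uniq wfF rv rz).
  + case: rv rz => x [Fv pv _] [y [Gz pz _]].
    have [n Fu] := wf_parent wfF Fv pv.
    by case: (noparent2 _ _ _ _ _ Gz pz Fu).
  + case: rv rz => x [Fv pv _] [y [Gz pz _]].
    have [n Fu] := wf_parent wfG Fv pv.
    by case: (noparent1 _ _ _ _ _ Gz pz Fu).
  + exact: (wf_rank_uniq wfG rv rz).
- move=> u x r /lk[]Fu.
    rewrite -(wf_rank wfF r Fu); split=> -[z]; last by exists z; apply/rc; left.
    case/rc; first by exists z.
    by case=> y [Gz pz _]; case: (noparent2 _ _ _ _ _ Gz pz Fu).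
  rewrite -(wf_rank wfG r Fu); split=> -[z]; last by exists z; apply/rc; right.
  case/rc; last by exists z.
  by case=> y [Gz pz _]; case: (noparent1 _ _ _ _ _ Gz pz Fu).
- move=> u v x y e /lk[]Fu /lk[]Fv ox oy.
  + exact: (wf_items wfF Fu Fv ox oy).
  + by case: (iFG e (key x) (key y)); [exists u, x|exists v, y].
  + by case: (iFG e (key y) (key x)); [exists v, y|exists u, x].
  + exact: (wf_items wfG Fu Fv ox oy).
Qed.

Lemma wf_empty : wf ([fmap] : forest K E).
Proof.
split=> *; try by match goal with h : _ = Some _ |- _ =>
  rewrite fnd_fmap0 in h end.
by match goal with h : ranked_child _ _ _ _ |- _ =>
  case: h => ? []; rewrite fnd_fmap0 end.
Qed.

(** Adding a node at a fresh address is a disjoint union with this forest, so [wf_cat] covers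
    insertions as well as melds. *)
Definition singleton v e k : forest K E := [fmap].[v <- Node (Full e) k 0 None].

Lemma fnd_singleton v e k z x : (singleton v e k).[? z] = Some x ->
  z = v /\ x = Node (Full e) k 0 None.
Proof. by rewrite fnd_set; case: eqP => [-> [<-]|_]; last rewrite fnd_fmap0. Qed.

Lemma is_root_singleton v e k z : is_root (singleton v e k) z = (z == v).
Proof.
by rewrite /is_root fnd_set; case: eqP => //= _; rewrite fnd_fmap0.
Qed.

Lemma item_singleton v e k e' k' :
  item (singleton v e k) e' k' <-> e' = e /\ k' = k.
Proof.
split=> [[z [x [/fnd_singleton[_ ->] /= [<-] <-]]]|[-> ->]] //.
by exists v, (Node (Full e) k 0 None); rewrite fnd_set eqxx.
Qed.

Lemma wf_singleton v e k : wf (singleton v e k).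
Proof.
have norc t r z : ~ ranked_child (singleton v e k) t r z.
  by case=> x [/fnd_singleton[_ ->]].
split.
- move=> z x /fnd_singleton[-> _]; apply: grounded_root.
  by rewrite is_root_singleton.
- by move=> u z b x y _ /fnd_singleton[_ ->].
- by move=> u r w z /norc.
- by move=> u x r /fnd_singleton[_ ->]; split=> [[w /norc]|[]].
- by move=> u z x y f /fnd_singleton[-> _] /fnd_singleton[-> _].
Qed.

(** * Destroying a root *)

Lemma wf_destroy F u : wf F -> is_root F u -> wf (destroy u F).
Proof.
move=> wfF /is_rootP[x0 Fu px0].
have old z n : (destroy u F).[? z] = Some n -> exists n0,
    [/\ z <> u, F.[? z] = Some n0, key n = key n0,
        occ n = occ n0 /\ rank n = rank n0 &
        parent n = if omap fst (parent n0) == Some u then None else parent n0].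
  rewrite fnd_destroy; case: eqP => // zu; case: F.[? z] => [n0|//] /= [<-].
  by exists n0; case: ifP.
have new z n0 : z != u -> F.[? z] = Some n0 ->
    omap fst (parent n0) != Some u -> (destroy u F).[? z] = Some n0.
  by rewrite fnd_destroy => /negPf-> -> /negPf /= ->.
(* As a root, [u] is nobody's ranked child, so its removal takes no child away from another node. *)
have rc t r z : ranked_child (destroy u F) t r z <->
    t <> u /\ ranked_child F t r z.
  split=> [[n [/old[n0 [zu Fz _ [_ rn]]]]]|[tu [n [Fz pz rz]]]].
    case: eqP => pz -> // pt <-; split; last by exists n0.
    by move=> tu; rewrite pt tu in pz.
  exists n; split=> //; apply: new => //.
    by apply/eqP => zu; move: Fz pz; rewrite zu Fu => -[<-]; rewrite px0.
  by rewrite pz; apply/eqP => -[].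
(* A derivation that passes through [u] now stops at the child of [u], which has become a root. *)
have ground z : grounded F z -> z != u -> grounded (destroy u F) z.
  elim=> {}z => [/is_rootP[n Fz pz] zu|v b n Fz pz _ IH zu].
    by apply/grounded_root/is_rootP; exists n => //; apply: new => //; rewrite pz.
  case vu: (v == u); last first.
    apply: (grounded_child (new _ _ zu Fz _) pz (IH _)); last by rewrite vu.
    by rewrite pz; apply/eqP => -[] /eqP; rewrite vu.
  apply/grounded_root/is_rootP; rewrite fnd_destroy (negPf zu) Fz /= pz /= (eqP vu).
  by rewrite eqxx; exists (set_parent None n).
split.
- move=> z n /old[n0 [zu Fz _ _ _]]; apply: ground; last exact/eqP.
  exact: (wf_grounded wfF Fz).
- move=> z v b n m /old[n0 [_ Fz -> _ _]] /old[m0 [_ Fv -> _]].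
  by case: eqP => _ -> // pm; apply: (wf_order wfF Fz Fv pm).
- by move=> t r v z /rc[_ rv] /rc[_]; apply: (wf_rank_uniq wfF).
- move=> t n r /old[n0 [tu Ft _ [on ->] _]].
  have -> : split_by_decrease_key n = split_by_decrease_key n0.
    by rewrite /split_by_decrease_key on.
  rewrite -(wf_rank wfF r Ft); split=> -[z]; last by exists z; apply/rc.
  by case/rc => _; exists z.
- move=> v z n m e /old[n0 [_ Fv _ [-> _] _]] /old[m0 [_ Fz _ [-> _] _]].
  exact: (wf_items wfF Fv Fz).
Qed.

Lemma item_destroy F u e k : ~~ full_at F u ->
  item (destroy u F) e k <-> item F e k.
Proof.
move=> hu; split=> -[z [n [Fz oz kz]]].
  move: Fz; rewrite fnd_destroy; case: eqP => // _.
  case Fz: F.[? z] => [n0|//] /= [nE]; exists z, n0.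
  by split=> //; [rewrite -oz -nE|rewrite -kz -nE]; case: ifP.
exists z, (if omap fst (parent n) == Some u then set_parent None n else n).
rewrite fnd_destroy Fz /=; case: eqP => [zu|_].
  by case/negP: hu; apply/full_atP; exists n; [rewrite -zu|apply/is_fullP; exists e].
by split=> //; case: ifP.
Qed.

(** * Splitting a node by decrease-key *)

Section SplitNode.

Variables (F : forest K E) (e : E) (k : K) (u : address) (x : node K E).
Variables (v : address) (S : {fset address}).
Hypotheses (wfF : wf F) (Fu : F.[? u] = Some x) (ox : occ x = Full e).
Hypotheses (ru : ~~ is_root F u) (vF : v \notin domf F).

Let G := split_node e k u x v S F.

Lemma split_node_fresh_parent z n b :
  F.[? z] = Some n -> parent n <> Some (v, b).
Proof.
move=> Fz pz; have [y Fv] := wf_parent wfF Fz pz.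
by case/negP: vF; apply/in_domfP; exists y.
Qed.

(** The second component is an implication because the bound on the rank concerns ranked children
    only; unranked ones are moved according to [S]. *)
Lemma split_node_parent_moved z n : F.[? z] = Some n ->
  moved_child u (rank x - 2) S F z -> exists2 b, parent n = Some (u, b) &
    b -> rank n < rank x - 2.
Proof.
rewrite /moved_child => -> /orP[]/andP[/eqP pz rz]; last by exists false.
by exists true.
Qed.

Lemma split_node_old z n : G.[? z] = Some n ->
  (z = v /\ n = Node (Full e) k (rank x - 2) None) \/
  exists n0, [/\ z <> v, F.[? z] = Some n0, key n = key n0 /\ rank n = rank n0,
    occ n = (if z == u then HollowByDecreaseKey else occ n0) &
    parent n = parent n0 \/
    exists b, parent n0 = Some (u, b) /\ parent n = Some (v, b)].
Proof.
rewrite fnd_split_node; case: eqP => [-> [<-]|zv]; first by left.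
move=> Gz; right; case: (z =P u) zv Gz => [-> uv [<-]|_ zv].
  by exists x; split=> //; left.
case Fz: F.[? z] => [n0|]; last by rewrite if_same.
case: ifP => [mz|_] [<-]; exists n0; split=> //; last by left.
have [b pz _] := split_node_parent_moved Fz mz.
by right; exists b; rewrite /= pz.
Qed.

Lemma split_node_new z n0 : F.[? z] = Some n0 -> exists n,
  [/\ G.[? z] = Some n, key n = key n0 &
      occ n = if z == u then HollowByDecreaseKey else occ n0].
Proof.
move=> Fz; rewrite fnd_split_node.
case: eqP => [zv|_].
  by case/negP: vF; apply/in_domfP; exists n0; rewrite -zv.
case: eqP => [zu|_].
  by exists (set_occ HollowByDecreaseKey x); move: Fz; rewrite zu Fu => -[<-].
by rewrite Fz; case: ifP => _ /=; eexists.
Qed.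

(** Besides the children of [u] divided at rank [rank x - 2], nothing changes: [u] may itself be a
    ranked child, but it keeps its rank and parent when it becomes hollow. By freshness, [v] had no
    children before. *)
Lemma ranked_child_split_node t r z :
  ranked_child G t r z <->
  if t == v then ranked_child F u r z /\ r < rank x - 2
  else ranked_child F t r z /\ (t = u -> rank x - 2 <= r).
Proof.
split=> [[n []]|].
  rewrite fnd_split_node; case: eqP => [_ [<-]//|zv].
  case: eqP => [->|zu].
    case=> <- /= pt <-; case: eqP => [tv|_].
      by case: (split_node_fresh_parent Fu (b := true)); rewrite pt tv.
    split; first by exists x.
    by move=> tu; case: (grounded_irrefl (wf_grounded wfF Fu) Fu (b := true));
      rewrite pt tu.
  case Fz: F.[? z] => [n0|]; last by rewrite if_same.
  case: ifP => [mz|mz] [<-].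
    have [b pz rz] := split_node_parent_moved Fz mz.
    rewrite /= pz /= => -[<- bt] <-; subst b; rewrite eqxx.
    by split; [exists n0|apply: rz].
  move=> pz rz; case: eqP => [tv|_].
    by case: (split_node_fresh_parent Fz (b := true)); rewrite pz tv.
  split=> [|tu]; first by exists n0.
  move/negbT: mz; rewrite /moved_child Fz pz tu eqxx /= rz.
  by case/norP; rewrite -leqNgt.
case: eqP => [->|tv] [[n [Fz pz rz]] rr].
  have zv : z == v = false.
    by apply/eqP => zv; case/negP: vF; apply/in_domfP; exists n; rewrite -zv.
  have zu : z == u = false.
    apply/eqP => zu; case: (grounded_irrefl (wf_grounded wfF Fz) Fz (b := true)).
    by rewrite pz zu.
  exists (set_parent (Some (v, true)) n); split=> //.
  by rewrite fnd_split_node zv zu /moved_child Fz pz eqxx rz rr /= pz.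
have zv : z == v = false.
  by apply/eqP => zv; case/negP: vF; apply/in_domfP; exists n; rewrite -zv.
case: (z =P u) => [zu|zu].
  exists (set_occ HollowByDecreaseKey x).
  rewrite fnd_split_node zv zu eqxx.
  by move: Fz; rewrite zu Fu => -[->].
exists n; split=> //; rewrite fnd_split_node zv; case: eqP => // _.
case: ifP => // mz; have [b pb rb] := split_node_parent_moved Fz mz.
move: pb; rewrite pz => -[tu bt]; move: (rr tu) (rb (esym bt)).
by rewrite rz leqNgt => /negPf->.
Qed.

Lemma is_root_split_node z : is_root G z = (z == v) || is_root F z.
Proof.
apply/is_rootP/orP => [[n /split_node_old[[-> _] _|]]|].
- by left.
- case=> n0 [_ Fz _ _ [->|[b [_ ->]]]] // pz.
  by right; apply/is_rootP; exists n0.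
case=> [/eqP->|/is_rootP[n Fz pz]].
  by exists (Node (Full e) k (rank x - 2) None); rewrite ?fnd_split_node ?eqxx.
exists n => //; rewrite fnd_split_node.
case: eqP => [zv|_].
  by case/negP: vF; apply/in_domfP; exists n; rewrite -zv.
case: eqP => [zu|_].
  by case/negP: ru; apply/is_rootP; exists n => //; rewrite -zu.
by rewrite /moved_child Fz pz.
Qed.

(** [u] was the only node holding [e], so once it is hollow the new node is the sole holder. *)
Lemma item_split_node e' k' :
  item G e' k' <-> (if e' == e then k' = k else item F e' k').
Proof.
split=> [[z [n [/split_node_old[[_ ->]|]]]]|].
- by move=> /= [->] ->; rewrite eqxx.
- case=> n0 [_ Fz [kn _] -> _]; case: eqP => // zu on <-.
  case: eqP => [ee|_]; last by exists z, n0.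
  by case: zu; apply: (wf_items wfF Fz Fu on); rewrite ee.
case: eqP => [-> ->|ee [z [n [Fz on kn]]]].
  exists v, (Node (Full e) k (rank x - 2) None).
  by rewrite fnd_split_node eqxx.
have [n' [Gz kn' on']] := split_node_new Fz.
exists z, n'; split=> //; last by rewrite kn'.
rewrite on'; case: eqP => // zu; move: on; move: Fz; rewrite zu Fu => -[<-].
by rewrite ox => -[e'e]; case: ee.
Qed.

Lemma wf_split_node : (k <= key x)%O -> wf G.
Proof.
move=> kx; have rv : is_root G v by rewrite is_root_split_node eqxx.
(* A moved child hangs directly below the root [v]; every other old node keeps its parent. *)
have ground z : grounded F z -> grounded G z.
  elim=> {}z => [rz|w b n Fz pz _ IH].
    by apply: grounded_root; rewrite is_root_split_node rz orbT.
  have [n' [Gz _ _]] := split_node_new Fz.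
  case: (split_node_old Gz) => [[-> _]|]; first exact: grounded_root.
  case=> n0 [_]; rewrite Fz => -[<-] _ _ [pn|[c [_ pn]]].
    by apply: (grounded_child Gz _ IH); rewrite pn; apply: pz.
  by apply: (grounded_child Gz pn); apply: grounded_root.
split.
- move=> z n /split_node_old[[-> _]|[n0 [_ Fz _ _ _]]]; first exact: grounded_root.
  exact: ground (wf_grounded wfF Fz).
- move=> z w b n m Gz /split_node_old[[_ ->]//|[m0 [_ Fw [-> _] _ pm]]] pw.
  case: (split_node_old Gz) => [[zv ->]|[n0 [zv Fz [-> _] _ _]]].
    (* For a moved child, [k] is at most the old key of [u], which is at most the key of the child.
       An unmoved child of [v] cannot exist. *)
    case: pm => [pm|[c [pm _]]]; last first.
      by apply: le_trans kx (wf_order wfF Fu Fw pm).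
    by case: (split_node_fresh_parent Fw (b := b)); rewrite -pm pw zv.
  case: pm => [pm|[c [_ pm]]]; last by case: zv; move: pw; rewrite pm => -[].
  by apply: (wf_order wfF Fz Fw); rewrite -pm; apply: pw.
- move=> t r w z /ranked_child_split_node + /ranked_child_split_node.
  by case: eqP => _ [rw _] [rz _]; apply: (wf_rank_uniq wfF rw rz).
- move=> t n r Gt.
  transitivity (if t == v then (exists z, ranked_child F u r z) /\ r < rank x - 2
    else (exists z, ranked_child F t r z) /\ (t = u -> rank x - 2 <= r)).
    split=> [[z /ranked_child_split_node]|].
      by case: eqP => _ [rz rr]; split=> //; exists z.
    case tv: (t == v) => -[[z rz] rr]; exists z;
      by apply/ranked_child_split_node; rewrite tv.
  (* [u] was full, so all ranks below [rank x] were present. Those below [rank x - 2] go to [v], as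
     its rank demands; the others stay at [u], as [wf_rank] demands of a split node. *)
  have rF := wf_rank wfF r Fu.
  have {}rF : (exists z, ranked_child F u r z) <-> r < rank x.
    by rewrite rF full_not_split; [split=> // -[]|rewrite /is_full ox].
  case: (split_node_old Gt) => [[-> ->]|[n0 [tv Ft [_ rn] on _]]].
    rewrite eqxx rF; split=> [[_ rr]|[rr _]]; split=> //.
    by apply: leq_trans rr (leq_subr _ _).
  case: eqP => // _; case: (t =P u) => tu; last first.
    rewrite /split_by_decrease_key on; case: eqP => // _.
    by rewrite rn (wf_rank wfF r Ft); split=> [[]|].
  move: Ft on; rewrite rn tu Fu eqxx => -[<-] on; rewrite rF.
  (* With truncated subtraction, [rank x - 2 <= r] is equivalent to [rank x <= r + 2] for every
     rank, so small ranks are covered too. *)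
  rewrite /split_by_decrease_key on leq_subLR addnC.
  by split=> -[rr rx]; split=> // _; apply: rx.
- move=> z w n m f /split_node_old[[-> ->]|[n0 [_ Fz _ on _]]]
    /split_node_old[[-> ->]|[m0 [_ Fw _ om _]]] //=.
  + case=> ef; move: om; case: eqP => [_ -> //|wu -> om]; case: wu.
    by apply: (wf_items wfF Fw Fu om); rewrite -ef.
  + move=> nf [ef]; move: on nf; case: eqP => [_ -> //|zu -> on]; case: zu.
    by apply: (wf_items wfF Fz Fu on); rewrite -ef.
  + rewrite on om; case: eqP => // _; case: eqP => // _.
    exact: (wf_items wfF Fz Fw).
Qed.

Lemma full_at_split_node z : is_root F z || (z == v) -> full_at F z || (z == v) ->
  full_at G z.
Proof.
rewrite /full_at fnd_split_node; case: eqP => //= _; rewrite !orbF.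
case: eqP => [->|_ rz]; first by rewrite (negPf ru).
by case: ifP => //; case: F.[? z].
Qed.

End SplitNode.

(** * Phases: invariant, termination and progress *)

Implicit Types (P Q R : phase K E).

Lemma full_at_link b F w l F' z : link b F w l F' -> full_at F' z = full_at F z.
Proof.
case=> x y Fw Fl wl _ _ fx fy _ _; rewrite /full_at !fnd_set.
case: eqP => [->|_]; first by rewrite Fl.
by case: eqP => [->|//]; rewrite Fw; case: (b).
Qed.

Lemma domf_link b F w l F' : link b F w l F' -> domf F' = domf F.
Proof.
case=> x y Fw Fl _ _ _ _ _ _ _; rewrite !dom_setf fsetUA.
apply/fsetP => z; rewrite !inE; case: eqP => [->|_] /=.
  by apply/esym/in_domfP; exists y.
by case: eqP => [->|//]; apply/esym/in_domfP; exists x.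
Qed.

Lemma domf_destroy u F : domf (destroy u F) = domf F `\ u.
Proof. by rewrite domf_rem. Qed.

Lemma no_hollow_root_link b F w l F' :
  link b F w l F' -> no_hollow_root F -> no_hollow_root F'.
Proof.
move=> L hF z; rewrite (is_root_link z L) (full_at_link z L) => /andP[_].
exact: hF.
Qed.

(** While a deletion runs, roots may be hollow and numerous, so only [wf] is kept; the exit
    conditions of the loop restore the rest. The last clause for [Melding] makes the two roots
    distinct, as [link] requires. *)
Definition phase_ok (P : phase K E) : Prop :=
  match P with
  | Melding F o1 o2 =>
      [/\ wf F, no_hollow_root F,
          forall u, is_root F u <-> o1 = Some u \/ o2 = Some u
        & forall u, o1 = Some u -> o2 <> Some u]
  | Deleting F => wf F
  | Done H =>
      [/\ wf (hnodes H), no_hollow_root (hnodes H)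
        & forall u, is_root (hnodes H) u <-> hroot H = Some u]
  end.

Lemma phase_ok_wf P : phase_ok P -> wf (phase_forest P).
Proof. by case: P => [F o1 o2 []|F|H []]. Qed.

Lemma phase_ok_step P Q : phase_ok P -> step P Q -> phase_ok Q.
Proof.
move=> + PQ; case: PQ => {P Q} /=.
- by move=> F o [wfF hF rF _]; split=> // u; rewrite rF; split=> [[]|]; auto.
- by move=> F o [wfF hF rF _]; split=> // u; rewrite rF; split=> [[]|]; auto.
- move=> F u v F' L [wfF hF rF _]; split; first exact: wf_link L.
    exact: no_hollow_root_link L hF.
  have vu : u != v by case: L.
  move=> z; rewrite (is_root_link z L); split.
    by case/andP => /eqP zv /rF[|[] /esym].
  by case=> <-; rewrite vu; apply/rF; left.
- move=> F u v F' L [wfF hF rF _]; split; first exact: wf_link L.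
    exact: no_hollow_root_link L hF.
  have vu : v != u by case: L.
  move=> z; rewrite (is_root_link z L); split.
    by case/andP => /eqP zv /rF[[] /esym|].
  by case=> <-; rewrite vu; apply/rF; right.
- by move=> F u ru _ wfF; apply: wf_destroy.
- by move=> F w l F' _ L wfF; apply: wf_link L.
- by move=> F w l F' _ _ L wfF; apply: wf_link L.
- move=> F rF wfF; have nr u : ~ is_root F u by rewrite -in_roots rF.
  by split=> // u; [move/nr|split=> [/nr|]].
- move=> F u rF fu wfF; have rE z : is_root F z = (z == u).
    by rewrite -in_roots rF in_fset1.
  split=> // [z|z]; first by rewrite rE => /eqP->.
  by rewrite rE; split=> [/eqP->|[->]].
Qed.

Lemma item_step P Q e k :
  step P Q -> item (phase_forest Q) e k <-> item (phase_forest P) e k.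
Proof.
case=> [F o|F o|F u v F' L|F u v F' L|F u _ fu|F w l F' _ L|F w l F' _ _ L|F _|F u _ _]
  //; try exact: item_link L; exact: item_destroy.
Qed.

Lemma domf_step P Q :
  step P Q -> {subset domf (phase_forest Q) <= domf (phase_forest P)}.
Proof.
case=> [F o|F o|F u v F' L|F u v F' L|F u _ _|F w l F' _ L|F w l F' _ _ L|F _|F u _ _]
  z //; try by rewrite /= (domf_link L).
by rewrite -[phase_forest _]/(destroy u F) domf_destroy inE => /andP[].
Qed.

(** Addresses can only disappear and the items stay fixed, so the contents of the final heap and its
    separation from the other heaps can be established on the first phase. *)
Lemma steps_invariant P Q : steps P Q -> phase_ok P ->
  [/\ phase_ok Q, {subset domf (phase_forest Q) <= domf (phase_forest P)} &
      forall e k, item (phase_forest Q) e k <-> item (phase_forest P) e k].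
Proof.
elim=> {P Q} [P okP|P Q R PQ _ IH okP]; first by split.
have [okR dR iR] := IH (phase_ok_step okP PQ).
split=> // [z /dR /(domf_step PQ) //|e k].
by rewrite iR (item_step _ _ PQ).
Qed.

(* Destroying a root removes a node but may create many roots; a link keeps the
   nodes and removes a root. Hence the lexicographic order. *)
Lemma acc_deleting F : Acc (fun Q P : phase K E => step P Q) (Deleting F).
Proof.
have [n] := ubnP #|` domf F|.
elim: n F => [|n IHn] F; first by rewrite ltn0.
have [m] := ubnP #|` Defs.roots F|.
elim: m F => [|m IHm] F; first by rewrite ltn0.
move=> rm dn.
have links b w l F' : link b F w l F' -> Acc (fun Q P => step P Q) (Deleting F').
  move=> L; apply: IHm; last by rewrite (domf_link L).
  rewrite -ltnS (leq_trans _ rm) // ltnS; apply: fproper_ltn_card.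
  suff -> : Defs.roots F' = Defs.roots F `\ l.
    by apply: fproperD1; rewrite in_roots; case: L.
  by apply/fsetP => z; rewrite in_roots !in_fsetD1 in_roots (is_root_link z L).
have accD H : Acc (fun Q P => step P Q) (Done H) by split=> Q PQ; inversion PQ.
split=> Q PQ; inversion PQ as [| | | |F0 u ru|F0 w l F' _ L|F0 w l F' _ _ L| |];
  subst; [|exact: links L|exact: links L|exact: accD|exact: accD].
apply: IHn; rewrite domf_destroy -ltnS (leq_trans _ dn) // ltnS.
apply: fproper_ltn_card; apply: fproperD1.
by apply/in_domfP; case/is_rootP: ru => x; exists x.
Qed.

Lemma acc_phase P : Acc (fun Q P : phase K E => step P Q) P.
Proof.
have accD H : Acc (fun Q P => step P Q) (Done H) by split=> Q PQ; inversion PQ.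
case: P => [F o1 o2|F|H //]; last exact: acc_deleting.
by split=> Q PQ; inversion PQ.
Qed.

Lemma full_roots_link (b : bool) F u v : is_root F u -> is_root F v -> u != v ->
  full_at F u -> full_at F v ->
  (b -> omap (@rank _ _ _) F.[? u] = omap (@rank _ _ _) F.[? v]) ->
  (exists F', link b F u v F') \/ (exists F', link b F v u F').
Proof.
move=> ru rv uv /full_atP[x Fu fx] /full_atP[y Fv fy] rk.
have {}rk : b -> rank x = rank y by move/rk; rewrite Fu Fv => -[].
case: (leP (key x) (key y)) => [kxy|/ltW kyx]; [left|right].
  by eexists; apply: (Link Fu Fv).
by eexists; apply: (Link Fv Fu) => //; [rewrite eq_sym|move/rk].
Qed.

Lemma phase_progress P : phase_ok P ->
  (exists H, P = Done H) \/ exists Q, step P Q.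
Proof.
case: P => [F o1 o2|F wfF|H _]; last by left; exists H.
  case: o1 o2 => [u|] [v|] [_ hF rF uv]; right;
    try by eexists; constructor.
  have ru : is_root F u by apply/rF; left.
  have rv : is_root F v by apply/rF; right.
  have {}uv : u != v by apply/eqP => uv'; case: (uv u) => //; rewrite uv'.
  have [//|[F' L]|[F' L]] :=
      @full_roots_link false F u v ru rv uv (hF _ ru) (hF _ rv).
    by exists (Done (Heap (Some u) F')); apply: step_meld_link_l.
  by exists (Done (Heap (Some v) F')); apply: step_meld_link_r.
(* The guards of the loop are tried in turn: a hollow root, two roots of equal rank, no root,
   exactly one root, and otherwise two roots for an unranked link. Each existence question is
   decided by testing a finite set for emptiness. *)
right; have [hF|[u]] := fset_0Vmem [fset u in Defs.roots F | ~~ full_at F u];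
    last first.
  rewrite inE /= inE /= in_roots => /andP[ru fu].
  by exists (Deleting (destroy u F)); apply: step_destroy.
have {}hF : no_hollow_root F.
  move=> u ru; apply/negPn/negP => fu.
  by have : u \in fset0; rewrite // -hF inE /= inE /= in_roots ru.
pose same p := (p.1 != p.2) &&
  (omap (@rank _ _ _) F.[? p.1] == omap (@rank _ _ _) F.[? p.2]).
have [eF|[[u v]]] := fset_0Vmem [fset p in Defs.roots F `*` Defs.roots F | same p];
    last first.
  rewrite inE /= inE /= in_fsetM /= !in_roots => /andP[/andP[ru rv] /andP[/= uv /eqP rk]].
  have [//|[F' L]|[F' L]] :=
      @full_roots_link true F u v ru rv uv (hF _ ru) (hF _ rv);
    by exists (Deleting F'); apply: step_ranked_link L.
have {}eF u v : ~ equal_rank_roots F u v.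
  move=> [uv ru rv rk]; have : (u, v) \in fset0; rewrite // -eF inE /= inE /=.
  by rewrite in_fsetM /= !in_roots ru rv /same /= uv rk eqxx.
have [rF|[u ru]] := fset_0Vmem (Defs.roots F).
  by exists (Done (Heap None F)); apply: step_no_root.
have [rF|[v]] := fset_0Vmem (Defs.roots F `\ u).
  exists (Done (Heap (Some u) F)); apply: step_one_root; last first.
    by apply: hF; rewrite -in_roots.
  by rewrite -(fsetD1K ru) rF fsetU0.
rewrite in_fsetD1 eq_sym !in_roots => /andP[uv rv]; rewrite in_roots in ru.
have [//|[F' L]|[F' L]] :=
    @full_roots_link false F u v ru rv uv (hF _ ru) (hF _ rv);
  by exists (Deleting F'); apply: step_unranked_link L.
Qed.

Lemma phase_ok_terminates P : phase_ok P -> terminates P.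
Proof.
move=> okP; split=> [|Q PQ]; first exact: acc_phase.
by apply: phase_progress; have [] := steps_invariant PQ okP.
Qed.

(** Progress supplies one step after another, and induction on accessibility ends the chain at a
    [Done]. *)
Lemma terminates_done P : terminates P -> exists H, steps P (Done H).
Proof.
case=> accP; elim: accP => {}P _ IH prP.
case: (prP P) => [|[H ->]|[Q PQ]]; try by [constructor|exists H; constructor].
have [|H QH] := IH Q PQ.
  by move=> R QR; apply: prP; apply: Relation_Operators.rt1n_trans PQ QR.
by exists H; apply: Relation_Operators.rt1n_trans PQ QH.
Qed.

(** * From the invariant to rank lists, trees, contents and minima *)

Lemma fnd_val (T : choiceType) (V : Type) (f : {fmap T -> V}) a b :
  f.[? a] = Some b -> exists2 c : domf f, val c = a & f c = b.
Proof.
move=> fa; have aD : a \in domf f by apply/in_domfP; exists b.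
by exists [` aD] => //; apply: Some_inj; rewrite Some_fnd.
Qed.

Lemma mem_ranked_child_ranks F u r :
  reflect (exists w, ranked_child F u r w) (r \in ranked_child_ranks F u).
Proof.
rewrite /ranked_child_ranks /nodes /image_mem filter_map -map_comp.
apply: (iffP mapP) => [[w]|[w [y [Fw py <-]]]].
  rewrite mem_filter => /andP[/eqP pw _] ->; exists (val w), (F w).
  by rewrite Some_fnd.
have [c _ Fc] := fnd_val Fw; exists c; last by rewrite /= Fc.
rewrite mem_filter; apply/andP; split; last exact: mem_enum.
by rewrite /= Fc py.
Qed.

Lemma uniq_ranked_child_ranks F u : wf F -> uniq (ranked_child_ranks F u).
Proof.
move=> wfF; rewrite /ranked_child_ranks /nodes /image_mem filter_map -map_comp.
rewrite map_inj_in_uniq; first by apply: filter_uniq; apply: (enum_uniq (domf F)).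
move=> v w.
rewrite !mem_filter => /andP[/eqP pv _] /andP[/eqP pw _] /= rvw.
apply: val_inj; apply: (wf_rank_uniq wfF (u := u) (r := rank (F v))).
  by exists (F v); rewrite Some_fnd.
by exists (F w); rewrite Some_fnd.
Qed.

(** Both lists are free of duplicates, so it suffices that they have the same members. *)
Lemma wf_rank_invariant F : wf F -> rank_invariant F.
Proof.
move=> wfF u x Fu; have rF r := wf_rank wfF r Fu.
case: ifP => [/andP[r2 dk]|dk]; apply: uniq_perm;
  rewrite ?uniq_ranked_child_ranks ?iota_uniq //.
(* [2 < rank x] keeps the truncated differences [rank x - 2] and [rank x - 1] distinct. *)
- rewrite /= inE andbT; case: (rank x) r2 => [|[|r]] // _.
  by rewrite !subSS subn0 subn0 (ltn_eqF (ltnSn r)).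
- move=> r; apply/mem_ranked_child_ranks/idP; rewrite rF.
    case=> rx /(_ dk); rewrite !inE addn2.
    case: (rank x) r2 rx => [|[|n]] // _; rewrite !subSS !subn0 !ltnS.
    by rewrite leq_eqVlt => /orP[/eqP->|]; rewrite ?eqxx ?orbT // ltnS eqn_leq => -> ->.
  rewrite !inE; case: (rank x) r2 => [|[|n]] // _; rewrite !subSS !subn0.
  by case/orP=> /eqP->; rewrite !addn2.
- move=> r; rewrite mem_iota add0n leq0n.
  apply/mem_ranked_child_ranks/idP; rewrite rF; first by case.
  (* A split node in this branch has rank at most 2, so the bound [rank x <= r + 2] is automatic. *)
  move=> rx; split=> // dx; move/negbT: dk; rewrite negb_and -leqNgt.
  by rewrite [X in ~~ X]dx orbF => /leq_trans-> //; rewrite leq_addl.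
Qed.

Lemma wf_heap_ordered F : wf F -> heap_ordered F.
Proof.
move=> wfF v w x y Fv Fw; rewrite /Defs.arc Fw => /andP[_].
by case py: (parent y) => [[z b]|] //= /eqP[zv]; subst z; apply: wf_order Fv Fw py.
Qed.

(** Read backwards, a derivation of [grounded] is a path from a root, and [u] is the only one. *)
Lemma grounded_path F u w : (forall z, is_root F z -> z = u) ->
  wf F -> grounded F w -> exists2 p, path (Defs.arc F) u p & last u p = w.
Proof.
move=> ru wfF; elim=> {}w => [/ru->|v b x Fw px gv [p pp pv]]; first by exists [::].
exists (rcons p w); last by rewrite last_rcons.
rewrite rcons_path pp pv /Defs.arc Fw px /= eqxx andbT.
by apply/in_domfP; apply: grounded_fnd.
Qed.

Lemma grounded_root_le F u x w y : (forall z, is_root F z -> z = u) ->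
  wf F -> grounded F w -> F.[? u] = Some x -> F.[? w] = Some y ->
  (key x <= key y)%O.
Proof.
move=> ru wfF gw Fu; elim: gw y => {}w => [/ru->|v b z Fw pz gv IH] y.
  by rewrite Fu => -[->].
rewrite Fw => -[<-]; have [n Fv] := grounded_fnd gv.
exact: le_trans (IH _ Fv) (wf_order wfF Fv Fw pz).
Qed.

Lemma phase_ok_heap_ordered_tree H : phase_ok (Done H) -> heap_ordered_tree H.
Proof.
case=> wfH hH rH; rewrite /heap_ordered_tree; case: (hroot H) rH => [u|] rH.
  have ru : is_root (hnodes H) u by apply/rH.
  split; [split=> // w|exact: wf_heap_ordered|exact: hH].
  case/in_domfP=> x Fw; apply: grounded_path (wf_grounded wfH Fw) => // z.
  by case/rH.
(* Without a root no derivation of [grounded] can begin, so there is no node at all. *)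
apply/fsetP=> w; rewrite inE; apply/negP => /in_domfP[x] /(wf_grounded wfH).
by elim=> {}w // /rH.
Qed.

(** The fold overwrites keys, so its value at [e] is the key of every holder of [e] only because
    [wf_items] leaves a single holder. *)
Lemma contentsP H e k : wf (hnodes H) ->
  (contents H).[? e] = Some k <-> item (hnodes H) e k.
Proof.
move=> wfH; rewrite /contents /nodes /image_mem; set F := hnodes H in wfH *.
have uF (v w : domf F) : occ (F v) = Full e -> occ (F w) = Full e -> v = w.
  by move=> ov ow; apply: val_inj; apply: (wf_items wfH _ _ ov ow); rewrite Some_fnd.
transitivity (exists2 w : domf F, w \in enum {: domf F} &
  occ (F w) = Full e /\ key (F w) = k).
  elim: (enum _) => [|v s IH] /=; first by rewrite fnd_fmap0; split=> [//|[]].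
  have nv : occ (F v) <> Full e -> (exists2 w : domf F, w \in v :: s &
      occ (F w) = Full e /\ key (F w) = k) ->
      exists2 w : domf F, w \in s & occ (F w) = Full e /\ key (F w) = k.
    by move=> ov [w]; rewrite inE => /orP[/eqP-> []//|ws ow]; exists w.
  have sv : (exists2 w : domf F, w \in s & occ (F w) = Full e /\ key (F w) = k) ->
      exists2 w : domf F, w \in v :: s & occ (F w) = Full e /\ key (F w) = k.
    by case=> w ws ow; exists w; rewrite // inE ws orbT.
  case ov: (occ (F v)) => [f||]; try by
    split=> [/IH/sv //|/nv]; rewrite ov => /(_ _)/IH; apply.
  rewrite fnd_set; case: eqP => [ef|ef].
    split=> [[<-]|[w _ [ow <-]]]; last by rewrite (uF w v) // ov ef.
    by exists v; rewrite ?mem_head // ov ef.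
  split=> [/IH/sv //|/nv]; rewrite ov => nvs; apply/IH; apply: nvs.
  by case=> fe; case: ef.
split=> [[w _ [ow kw]]|[u [x [Fu ox kx]]]].
  by exists (val w), (F w); rewrite Some_fnd.
have [c _ Fc] := fnd_val Fu; exists c; last by rewrite Fc.
exact: mem_enum.
Qed.

Lemma in_contents H e : wf (hnodes H) ->
  e \in domf (contents H) <-> exists k, item (hnodes H) e k.
Proof.
move=> wfH; split=> [/in_domfP[k /contentsP]|[k /contentsP eH]].
  by exists k; auto.
by apply/in_domfP; exists k; auto.
Qed.

Lemma find_min_is_min H : phase_ok (Done H) -> is_min (contents H) (find_min H).
Proof.
case=> wfH hH rH; rewrite /find_min; case: (hroot H) rH => [u|] rH; last first.
  apply/fsetP => e; rewrite inE; apply/negP => /(in_contents _ wfH)[k [u [x [Fu _ _]]]].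
  by elim: (wf_grounded wfH Fu) => {Fu}u // /rH.
have ru : is_root (hnodes H) u by apply/rH.
have /full_atP[x Fu] := hH u ru; rewrite Fu => /is_fullP[e ox]; rewrite ox /=.
exists (key x); first by apply/contentsP => //; exists u, x.
move=> e' k' /(contentsP _ _ wfH)[w [y [Fw _ <-]]].
by apply: grounded_root_le (wf_grounded wfH Fw) Fu Fw => // z /rH[].
Qed.

Lemma find_min_item H e : find_min H = Some e ->
  exists u x, [/\ hroot H = Some u, (hnodes H).[? u] = Some x & occ x = Full e].
Proof.
rewrite /find_min; case: (hroot H) => // u; case Fu: (hnodes H).[? u] => [x|] //.
by case ox: (occ x) => [f||] // -[<-]; exists u, x.
Qed.

(** * Worlds and the prescribed effect of an operation *)

Definition world_ok W : Prop :=
  separated W /\ forall h H, W.[? h] = Some H -> phase_ok (Done H).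

Lemma fnd_abstraction W h : (abstraction W).[? h] = omap (@contents _ _ _) W.[? h].
Proof.
case: (fndP (abstraction W) h) => [hW|hNW]; last by rewrite not_fnd.
by rewrite ffunE (@in_fnd _ _ W h hW).
Qed.

Lemma abstraction_set_rem W (A : {fset handle}) h H :
  abstraction W.[\ A].[h <- H] = (abstraction W).[\ A].[h <- contents H].
Proof.
apply/fmapP => h'; rewrite fnd_abstraction !fnd_set; case: eqP => // _.
by rewrite !fnd_rem; case: ifP => // _; rewrite fnd_abstraction.
Qed.

Lemma abstraction_some W h m : (abstraction W).[? h] = Some m ->
  exists2 H, W.[? h] = Some H & m = contents H.
Proof.
by rewrite fnd_abstraction; case: W.[? h] => [H|] //= [<-]; exists H.
Qed.

(** Functional form of the contents that [spec] prescribes for the returned heap, so that each phase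
    can be compared with it. For a legal operation every lookup under [odflt] succeeds. *)
Definition outcome (fm : handle -> option E) (A : {fmap handle -> {fmap E -> K}})
    (op : operation K E) : {fmap E -> K} :=
  let c h := odflt [fmap] A.[? h] in
  match op with
  | MakeHeap | FindMin _ => [fmap]
  | Insert e k h | DecreaseKey e k h => (c h).[e <- k]
  | DeleteMin h => if fm h is Some e then (c h).[~ e] else c h
  | Meld h1 h2 => c h1 + c h2
  | Delete e h => (c h).[~ e]
  end.

Lemma item_set_key F u x e k e' k' : wf F -> F.[? u] = Some x -> occ x = Full e ->
  item F.[u <- set_key k x] e' k' <-> if e' == e then k' = k else item F e' k'.
Proof.
move=> wfF Fu ox; split=> [[z [n]]|].
  rewrite fnd_set; case: eqP => [_ [[<-] /=]|zu [Fz oz kz]].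
    by rewrite ox => -[<-]; rewrite eqxx.
  case: eqP => [ee|_]; last by exists z, n.
  by case: zu; apply: (wf_items wfF Fz Fu oz); rewrite ee.
case: eqP => [-> ->|ee [z [n [Fz oz kz]]]].
  by exists u, (set_key k x); rewrite fnd_set eqxx.
exists z, n; rewrite fnd_set; case: eqP => // zu.
by move: Fz; rewrite zu Fu => -[xn]; move: oz; rewrite -xn ox => -[e'e]; case: ee.
Qed.

Lemma item_hollow F u x e e' k' : wf F -> F.[? u] = Some x -> occ x = Full e ->
  item F.[u <- set_occ HollowByDelete x] e' k' <-> e' != e /\ item F e' k'.
Proof.
move=> wfF Fu ox; split=> [[z [n]]|[ee [z [n [Fz oz kz]]]]].
  rewrite fnd_set; case: eqP => [_ [[<-] //]|zu [Fz oz kz]].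
  split; last by exists z, n.
  by apply/eqP => ee; case: zu; apply: (wf_items wfF Fz Fu oz); rewrite ee.
exists z, n; rewrite fnd_set; case: eqP => // zu.
move: Fz; rewrite zu Fu => -[xn]; move: oz; rewrite -xn ox => -[e'e].
by rewrite e'e eqxx in ee.
Qed.

Lemma wf_hollow F u x e : wf F -> F.[? u] = Some x -> occ x = Full e ->
  wf F.[u <- set_occ HollowByDelete x].
Proof.
move=> wfF Fu ox; apply: (wf_update wfF Fu) => //; last by left.
by apply/is_fullP; exists e.
Qed.

Lemma update_domf F u x x' : F.[? u] = Some x -> domf F.[u <- x'] = domf F.
Proof.
move=> Fu; rewrite dom_setf; apply/fsetP => z; rewrite !inE.
by case: eqP => // ->; apply/esym/in_domfP; exists x.
Qed.
Implicit Types (op : operation K E).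

Lemma outcome_lookup W h e k :
  world_ok W -> (odflt [fmap] (abstraction W).[? h]).[? e] = Some k <->
  exists2 H, W.[? h] = Some H & item (hnodes H) e k.
Proof.
case=> _ okW; rewrite fnd_abstraction.
case Wh: W.[? h] => [H|] /=; last by rewrite fnd_fmap0; split=> // -[].
rewrite contentsP; last by case: (okW _ _ Wh).
by split=> [|[_ [<-]]//]; exists H.
Qed.

Lemma rem1_lookup (m : {fmap E -> K}) e e' k' :
  m.[~ e].[? e'] = Some k' <-> e' != e /\ m.[? e'] = Some k'.
Proof. by rewrite fnd_rem1; case: (e' != e); split=> // -[]. Qed.

Lemma set_lookup (m : {fmap E -> K}) e k e' k' :
  m.[e <- k].[? e'] = Some k' <->
  if e' == e then k' = k else m.[? e'] = Some k'.
Proof. by rewrite fnd_set; case: eqP => // _; split=> [[->]|->]. Qed.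

Definition consumes W op v : Prop :=
  exists h H, [/\ h \in consumed op, W.[? h] = Some H & v \in domf (hnodes H)].

(** The address clause serves [separated]: a surviving heap shares no address with a consumed heap,
    and contains no fresh one. *)
Definition correct_phase W op P : Prop :=
  [/\ phase_ok P,
      forall v, v \in domf (phase_forest P) -> consumes W op v \/ fresh W v
    & forall e k, item (phase_forest P) e k <->
        (outcome (returned_min W) (abstraction W) op).[? e] = Some k].

Lemma consumes1 W op h H v : h \in consumed op -> W.[? h] = Some H ->
  v \in domf (hnodes H) -> consumes W op v \/ fresh W v.
Proof. by move=> hop Wh vH; left; exists h, H. Qed.

Lemma fresh_notin W h H v : fresh W v -> W.[? h] = Some H ->
  v \notin domf (hnodes H).
Proof. by move=> fv; apply: fv. Qed.

Lemma legal_insert W e k h : world_ok W -> legal (abstraction W) (Insert e k h) ->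
  forall h' H k', W.[? h'] = Some H -> ~ item (hnodes H) e k'.
Proof.
move=> [_ okW] [_ leg] h' H k' Wh iH.
have [wfH _ _] := okW _ _ Wh.
have /negP : e \notin domf (contents H).
  by apply: (leg h'); rewrite fnd_abstraction Wh.
by case; apply/in_contents => //; exists k'.
Qed.

(** Disjointness of addresses comes from [separated] and [h1 != h2], disjointness of items from
    legality. *)
Lemma legal_meld W h1 h2 H1 H2 : world_ok W ->
  legal (abstraction W) (Meld h1 h2) -> W.[? h1] = Some H1 -> W.[? h2] = Some H2 ->
  [/\ [disjoint domf (hnodes H1) & domf (hnodes H2)]%fset,
      [disjoint domf (contents H1) & domf (contents H2)]%fset
    & forall e k k', item (hnodes H1) e k -> item (hnodes H2) e k' -> False].
Proof.
move=> [[sepW _] okW] [h12 [m1 [m2 [Ah1 Ah2 dm]]]] W1 W2.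
move: Ah1 Ah2; rewrite !fnd_abstraction W1 W2 /= => -[m1E] [m2E].
rewrite -m1E -m2E in dm.
have [wf1 _ _] := okW _ _ W1; have [wf2 _ _] := okW _ _ W2.
split=> // [|e k k' i1 i2].
  apply/fdisjointP => v v1; apply/negP => v2.
  by move: h12; rewrite (sepW _ _ _ _ _ W1 W2 v1 v2) eqxx.
have e1 : e \in domf (contents H1) by apply/in_contents => //; exists k.
have e2 : e \in domf (contents H2) by apply/in_contents => //; exists k'.
by have := fdisjointP dm _ e1; rewrite e2.
Qed.

(** * The first phase of each operation *)

Lemma correct_make_heap W : correct_phase W MakeHeap (Done (Heap None [fmap])).
Proof.
have nr u : ~ is_root ([fmap] : forest K E) u by rewrite /is_root fnd_fmap0.
split=> /= [|v|e k]; [|by rewrite inE|].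
  split; [exact: wf_empty|by move=> u /nr|].
  by move=> u; split=> // /nr.
rewrite fnd_fmap0; split=> // -[u [x []]].
by rewrite fnd_fmap0.
Qed.

Lemma correct_insert W e k h H v : world_ok W ->
  legal (abstraction W) (Insert e k h) -> W.[? h] = Some H -> fresh W v ->
  correct_phase W (Insert e k h)
    (Melding (hnodes H).[v <- Node (Full e) k 0 None] (Some v) (hroot H)).
Proof.
move=> okW leg Wh fv; have inew := legal_insert okW leg.
have [wfH hH rH] := okW.2 _ _ Wh; have vH := fresh_notin fv Wh.
have GE : (hnodes H).[v <- Node (Full e) k 0 None] = (hnodes H + singleton v e k)%fmap.
  by rewrite /singleton catf_setr catf0.
have dG : [disjoint domf (hnodes H) & domf (singleton v e k)]%fset.
  apply/fdisjointP => z zH; rewrite dom_setf domf0 !inE orbF.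
  by apply: contraNneq vH => <-.
have rG u : is_root (hnodes H + singleton v e k)%fmap u <->
    Some v = Some u \/ hroot H = Some u.
  split=> [/(is_root_cat _ dG)[/rH|]|]; first by right.
    by rewrite is_root_singleton => /eqP->; left.
  case=> [[<-]|/rH ru]; apply/(is_root_cat _ dG); last by left.
  by right; rewrite is_root_singleton.
rewrite GE; split.
- split=> //.
  + apply: wf_cat => //; first exact: wf_singleton.
    by move=> f k1 k2 iH /item_singleton[fe _]; apply: (inew _ _ k1 Wh); rewrite -fe.
  + move=> u; rewrite -GE /full_at /is_root fnd_set; case: eqP => // _ ru.
    exact: hH.
  + by move=> u [<-] /rH /is_rootP[x Hv _]; case/negP: vH; apply/in_domfP; exists x.
- move=> z; rewrite -[phase_forest _]/(hnodes H + singleton v e k)%fmap.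
  rewrite domf_cat inE => /orP[zH|].
    by apply: consumes1 Wh zH; rewrite inE.
  by rewrite dom_setf domf0 !inE orbF => /eqP->; right.
- move=> f k'; rewrite /= set_lookup item_cat // item_singleton.
  case: eqP => [->|fe]; last rewrite outcome_lookup //.
    by split=> [[/(inew _ _ _ Wh)|[]]|->] //; right.
  split=> [[iH|[]]//|[H']]; first by exists H.
  by rewrite Wh => -[<-]; left.
Qed.

Lemma correct_meld W h1 h2 H1 H2 : world_ok W ->
  legal (abstraction W) (Meld h1 h2) -> W.[? h1] = Some H1 -> W.[? h2] = Some H2 ->
  correct_phase W (Meld h1 h2)
    (Melding (hnodes H1 + hnodes H2) (hroot H1) (hroot H2)).
Proof.
move=> okW leg W1 W2; have [dH dC iH] := legal_meld okW leg W1 W2.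
have [wf1 hr1 r1] := okW.2 _ _ W1; have [wf2 hr2 r2] := okW.2 _ _ W2.
split.
- split.
  + exact: wf_cat.
  + move=> u /(is_root_cat _ dH)[/hr1|/hr2] /full_atP[x Hu fx]; apply/full_atP;
      exists x => //; apply/(fnd_cat_disjoint _ _ dH); by [left|right].
  + move=> u; split=> [/(is_root_cat _ dH)[/r1|/r2]|]; try by [left|right].
    by case=> [/r1|/r2] ru; apply/(is_root_cat _ dH); [left|right].
  + move=> u /r1 /is_rootP[x Hu _] /r2 /is_rootP[y Hu' _].
    have /(fdisjointP dH)/negP[] : u \in domf (hnodes H1) by apply/in_domfP; exists x.
    by apply/in_domfP; exists y.
- move=> z; rewrite -[phase_forest _]/(hnodes H1 + hnodes H2)%fmap.
  rewrite domf_cat inE => /orP[zH|zH].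
    by apply: consumes1 W1 zH; rewrite !inE eqxx.
  by apply: consumes1 W2 zH; rewrite !inE eqxx orbT.
- move=> e k /=; rewrite item_cat // !fnd_abstraction W1 W2 /=.
  rewrite fnd_cat_disjoint //.
  by rewrite !contentsP.
Qed.

(** Legality compares [k] with the key recorded in the abstraction; as [e] has a single holder, that
    is the key of [x]. *)
Lemma legal_decrease_key W e k h H u x : world_ok W ->
  legal (abstraction W) (DecreaseKey e k h) -> W.[? h] = Some H ->
  (hnodes H).[? u] = Some x -> occ x = Full e -> (k <= key x)%O.
Proof.
move=> okW [m [k0 [+ + kk]]] Wh Hu ox; rewrite fnd_abstraction Wh => -[<-].
have [wfH _ _] := okW.2 _ _ Wh.
move=> /(contentsP _ _ wfH)[w [y [Hw oy yk]]].
have wu := wf_items wfH Hw Hu oy ox.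
by move: Hw; rewrite wu Hu => -[xy]; rewrite xy yk ltW.
Qed.

Lemma correct_decrease_key_root W e k h H u x : world_ok W ->
  legal (abstraction W) (DecreaseKey e k h) -> W.[? h] = Some H ->
  (hnodes H).[? u] = Some x -> occ x = Full e -> hroot H = Some u ->
  correct_phase W (DecreaseKey e k h)
    (Done (Heap (hroot H) (hnodes H).[u <- set_key k x])).
Proof.
move=> okW leg Wh Hu ox rHu; have [wfH hH rH] := okW.2 _ _ Wh.
have kx := legal_decrease_key okW leg Wh Hu ox.
have fx : is_full x by apply/is_fullP; exists e.
have /is_rootP[x' + px] : is_root (hnodes H) u by apply/rH.
rewrite Hu => -[xx]; rewrite -xx {x' xx} in px.
split.
- split=> /=.
  + apply: (wf_update wfH Hu) => //; last by right.
    by rewrite (@full_not_split (set_key k x)).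
  + move=> z; rewrite (is_root_update _ Hu) // /full_at fnd_set.
    by case: eqP => // _; apply: hH.
  + by move=> z; rewrite (is_root_update _ Hu).
- move=> z; rewrite -[phase_forest _]/((hnodes H).[u <- set_key k x]).
  rewrite (update_domf _ Hu) => zH.
  by apply: consumes1 Wh zH; rewrite inE.
- move=> e' k'; rewrite /= (item_set_key _ _ _ wfH Hu ox) set_lookup.
  case: eqP => // _; rewrite outcome_lookup //.
  by split=> [iH|[H']]; [exists H|rewrite Wh => -[<-]].
Qed.

Lemma nonroot H u x : phase_ok (Done H) -> hroot H <> Some u ->
  (hnodes H).[? u] = Some x -> ~~ is_root (hnodes H) u.
Proof. by case=> _ _ rH nu _; apply/negP => /rH. Qed.

Lemma correct_decrease_key_nonroot W e k h H u x v S : world_ok W ->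
  legal (abstraction W) (DecreaseKey e k h) -> W.[? h] = Some H ->
  (hnodes H).[? u] = Some x -> occ x = Full e -> hroot H <> Some u ->
  fresh W v ->
  correct_phase W (DecreaseKey e k h)
    (Melding (split_node e k u x v S (hnodes H)) (Some v) (hroot H)).
Proof.
move=> okW leg Wh Hu ox nu fv; have [wfH hH rH] := okW.2 _ _ Wh.
have kx := legal_decrease_key okW leg Wh Hu ox.
have ru := nonroot (okW.2 _ _ Wh) nu Hu; have vH := fresh_notin fv Wh.
split.
- split.
  + exact: wf_split_node.
  + move=> z; rewrite is_root_split_node // => rz.
    apply: full_at_split_node => //; first by rewrite orbC.
    by case/orP: rz => [->|/hH->]; rewrite ?orbT.
  + move=> z; rewrite is_root_split_node //; split.
      by case/orP => [/eqP->|/rH]; [left|right].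
    by case=> [[->]|/rH->]; rewrite ?eqxx ?orbT.
  + by move=> z [<-] /rH /is_rootP[y Hv _]; case/negP: vH; apply/in_domfP; exists y.
- move=> z /in_domfP[n /(split_node_old Hu)[[-> _]|]]; first by right.
  case=> n0 [_ Hz _ _ _]; apply: (consumes1 (h := h)) Wh _; first by rewrite inE.
  by apply/in_domfP; exists n0.
- move=> e' k' /=; rewrite item_split_node // set_lookup.
  case: eqP => // _; rewrite outcome_lookup //.
  by split=> [iH|[H']]; [exists H|rewrite Wh => -[<-]].
Qed.

Lemma domf_correct_delete W e h H u x : W.[? h] = Some H ->
  (hnodes H).[? u] = Some x ->
  forall v, v \in domf (hnodes H).[u <- set_occ HollowByDelete x] ->
  consumes W (Delete e h) v \/ fresh W v.
Proof.
move=> Wh Hu v; rewrite (update_domf _ Hu) => vH.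
by apply: consumes1 Wh vH; rewrite inE.
Qed.

Lemma item_correct_delete W e h H u x : world_ok W -> W.[? h] = Some H ->
  (hnodes H).[? u] = Some x -> occ x = Full e ->
  forall e' k', item (hnodes H).[u <- set_occ HollowByDelete x] e' k' <->
  (outcome (returned_min W) (abstraction W) (Delete e h)).[? e'] = Some k'.
Proof.
move=> okW Wh Hu ox e' k'; have [wfH _ _] := okW.2 _ _ Wh.
rewrite (item_hollow _ _ wfH Hu ox) rem1_lookup outcome_lookup //.
by split=> -[ee]; [move=> iH; split=> //; exists H|case=> H'; rewrite Wh => -[<-]].
Qed.

Lemma correct_start W op P : world_ok W -> legal (abstraction W) op ->
  start W op P -> correct_phase W op P.
Proof.
move=> okW + st; elim: st => {op P}.
- by move=> _; apply: correct_make_heap.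
- by move=> e k h H v Wh fv leg; apply: correct_insert.
- by move=> h1 h2 H1 H2 W1 W2 leg; apply: correct_meld.
- by move=> e k h H u x Wh Hu ox rHu leg; apply: correct_decrease_key_root.
- by move=> e k h H u x v S Wh Hu ox nu fv leg; apply: correct_decrease_key_nonroot.
- move=> e h H u x Wh Hu ox rHu _; split.
  + by apply: wf_hollow Hu ox; case: (okW.2 _ _ Wh).
  + exact: domf_correct_delete.
  + exact: item_correct_delete.
- move=> e h H u x Wh Hu ox nu _; have [wfH hH rH] := okW.2 _ _ Wh.
  split; [split=> /=|exact: domf_correct_delete|exact: item_correct_delete].
  + exact: wf_hollow Hu ox.
  + move=> z; rewrite (is_root_update _ Hu) // /full_at fnd_set.
    by case: eqP => [->|_]; [move/rH|apply: hH].
  + by move=> z; rewrite (is_root_update _ Hu).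
- move=> h H e P Wh mH st IH _.
  have [u [x [rHu Hu ox]]] := find_min_item mH.
  have [wfH _ _] := okW.2 _ _ Wh.
  (* [DeleteMin] starts as the [Delete] of the item found, and consumes the same heap; the induction
     hypothesis applies once that [Delete] is seen to be legal. *)
  have [|okP dP iP] := IH.
    exists (contents H); first by rewrite fnd_abstraction Wh.
    by apply/in_contents => //; exists (key x), u, x.
  by split=> // f k; rewrite iP /outcome /returned_min Wh mH.
Qed.

(** * Preservation of the invariant by executions *)

(** This keeps items separated: an item of the returned heap comes from a consumed heap or was in no
    heap, so no surviving heap holds it. *)
Lemma outcome_item W op e k : world_ok W -> legal (abstraction W) op ->
  (outcome (returned_min W) (abstraction W) op).[? e] = Some k ->
  (exists h H k', [/\ h \in consumed op, W.[? h] = Some H & item (hnodes H) e k'])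
  \/ forall h H k', W.[? h] = Some H -> ~ item (hnodes H) e k'.
Proof.
move=> okW leg.
have from h k' : h \in consumed op ->
    (odflt [fmap] (abstraction W).[? h]).[? e] = Some k' ->
    exists h H k', [/\ h \in consumed op, W.[? h] = Some H & item (hnodes H) e k'].
  by move=> hop /(outcome_lookup _ _ _ okW)[H Wh iH]; exists h, H, k'.
case: op leg from => [|h|f k0 h|h|h1 h2|f k0 h|f h] leg from; rewrite /outcome.
- by rewrite fnd_fmap0.
- by rewrite fnd_fmap0.
- move/set_lookup; case: eqP => [->|_] eE; first by right; apply: legal_insert leg.
  by left; apply: from eE; rewrite inE.
- case: returned_min => [f|] eE; left; last by apply: from eE; rewrite inE.
  by case/rem1_lookup: eE => _; apply: from; rewrite inE.
- rewrite fnd_cat; case: ifP => _ eE; left; apply: from eE;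
  by rewrite !inE eqxx ?orbT.
- move/set_lookup; case: eqP => [ef _|_ eE]; left; last by apply: from eE; rewrite inE.
  (* The item whose key changes was already in [h], under its old key [k1]. *)
  case: leg => m [k1 [Ah mf _]]; apply: (from h k1); first by rewrite inE.
  by rewrite Ah ef.
- by case/rem1_lookup => _ eE; left; apply: from eE; rewrite inE.
Qed.

Lemma correct_during W op Q : world_ok W -> legal (abstraction W) op ->
  during W op Q -> correct_phase W op Q.
Proof.
move=> okW leg [P /(correct_start okW leg)[okP dP iP] PQ].
have [okQ dQ iQ] := steps_invariant PQ okP; split=> // [v /dQ /dP //|e k].
by rewrite iQ.
Qed.

Lemma world_ok_exec W op r W' : world_ok W -> legal (abstraction W) op ->
  exec W op r W' -> world_ok W'.
Proof.
move=> okW leg ex; case: ex leg => // {}op H h' dur hW leg.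
have [okH dH iH] := correct_during okW leg dur.
have [[sepN sepE] okW2] := okW.
set W1 := _.[_ <- _].
have W1E h (G : heap K E) : W1.[? h] = Some G ->
    (h = h' /\ G = H) \/ [/\ h <> h', h \notin consumed op & W.[? h] = Some G].
  rewrite /W1 fnd_set; case: eqP => [-> [<-]|hh']; first by left.
  by rewrite fnd_rem; case: ifPn => // hc Wh; right.
(* An address of the new heap is consumed or fresh, and neither kind occurs in a surviving heap. *)
have crossN h (G : heap K E) u : h \notin consumed op -> W.[? h] = Some G ->
    u \in domf (hnodes H) -> u \in domf (hnodes G) -> False.
  move=> hc Wh uH uG; case: (dH u uH) => [[g [J [gc Wg uJ]]]|fu].
    by move: hc; rewrite (sepN _ _ _ _ _ Wh Wg uG uJ) gc.
  by have := fu _ _ Wh; rewrite uG.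
have crossE h (G : heap K E) u v x y e : h \notin consumed op -> W.[? h] = Some G ->
    (hnodes H).[? u] = Some x -> occ x = Full e ->
    (hnodes G).[? v] = Some y -> occ y = Full e -> False.
  move=> hc Wh Hu ox Gv oy.
  have iHe : item (hnodes H) e (key x) by exists u, x.
  have iGe : item (hnodes G) e (key y) by exists v, y.
  case: (outcome_item okW leg ((iH e _).1 iHe)) => [|nW]; last exact: nW Wh iGe.
  case=> g [J [k' [gc Wg [w [z [Jw oz _]]]]]].
  have [gh _] : g = h /\ w = v by apply: (sepE _ _ _ _ e); [exists J, z|exists G, y].
  by move: hc; rewrite -gh gc.
split; last by move=> h G /W1E[[_ ->]|[_ _ /okW2]].
split=> [h1 h2 G1 G2 u|h1 h2 u1 u2 e].
  move=> /W1E[[-> ->]|[n1 c1 E1]] /W1E[[-> ->]|[n2 c2 E2]] // d1 d2.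
  - by case: (crossN _ _ _ c2 E2 d1 d2).
  - by case: (crossN _ _ _ c1 E1 d2 d1).
  - exact: sepN E1 E2 d1 d2.
move=> [G1 [x1 [+ g1 o1]]] [G2 [x2 [+ g2 o2]]].
move=> /W1E[[-> G1E]|[n1 c1 E1]] /W1E[[-> G2E]|[n2 c2 E2]].
- by split=> //; case: okH => wfH _ _; subst G1 G2; apply: (wf_items wfH g1 g2 o1 o2).
- by subst G1; case: (crossE _ _ _ _ _ _ _ c2 E2 g1 o1 g2 o2).
- by subst G2; case: (crossE _ _ _ _ _ _ _ c1 E1 g2 o2 g1 o1).
- by apply: (sepE _ _ _ _ e); [exists G1, x1|exists G2, x2].
Qed.

Lemma reachable_world_ok W : reachable W -> world_ok W.
Proof.
elim=> {W} [|W op r W' _ okW leg]; last exact: world_ok_exec okW leg.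
split; first split.
- by move=> h1 h2 H1 H2 u; rewrite fnd_fmap0.
- by move=> h1 h2 u1 u2 e [H [x []]]; rewrite fnd_fmap0.
- by move=> h H; rewrite fnd_fmap0.
Qed.

(** * Existence of executions and agreement with the specification *)

Lemma exists_fresh_handle (V : Type) (f : {fmap handle -> V}) : exists h, h \notin domf f.
Proof.
exists (\max_(h : domf f) val h).+1; apply/negP => hf.
by have := @leq_bigmax _ (fun h : domf f => val h) [` hf]; rewrite ltnn.
Qed.

Lemma exists_fresh W : exists v, fresh W v.
Proof.
pose top (h : domf W) := \max_(u : domf (hnodes (W h))) val u.
exists (\max_h top h).+1 => h H Wh; apply/negP => vH.
have [c _ Wc] := fnd_val Wh; rewrite -Wc in vH.
have := @leq_bigmax _ (fun u : domf (hnodes (W c)) => val u) [` vH].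
by rewrite leqNgt ltnS => /negP[]; apply: leq_bigmax.
Qed.

Lemma start_delete W e h H : W.[? h] = Some H -> (exists k, item (hnodes H) e k) ->
  exists P, start W (Delete e h) P.
Proof.
move=> Wh [k [u [x [Hu ox _]]]].
have [rHu|/eqP nu] := eqVneq (hroot H) (Some u); eexists.
  exact: start_delete_root Wh Hu ox rHu.
exact: start_delete_nonroot Wh Hu ox nu.
Qed.

Lemma find_min_some H : phase_ok (Done H) -> domf (contents H) != fset0 ->
  exists e, find_min H = Some e.
Proof.
move/find_min_is_min; case: (find_min H) => [e|/= ->]; first by exists e.
by rewrite eqxx.
Qed.

Lemma exists_start W op : world_ok W -> legal (abstraction W) op ->
  (forall h, op <> FindMin h) -> exists P, start W op P.
Proof.
move=> okW; have [v fv] := exists_fresh W.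
case: op => [|h|e k h|h|h1 h2|e k h|e h] leg nq.
- by eexists; apply: start_make_heap.
- by case: (nq h).
- have [/in_domfP[m /abstraction_some[H Wh _]] _] := leg.
  by eexists; apply: start_insert Wh fv.
- have [m /abstraction_some[H Wh ->] nonempty] := leg.
  have [e mH] := find_min_some (okW.2 _ _ Wh) nonempty.
  have [u [x [_ Hu ox]]] := find_min_item mH.
  have [|P st] := @start_delete W e h H Wh; first by exists (key x), u, x.
  by exists P; apply: start_delete_min Wh mH st.
- have [_ [m1 [m2 [/abstraction_some[H1 W1 _] /abstraction_some[H2 W2 _] _]]]] := leg.
  by eexists; apply: start_meld W1 W2.
- have [m [k0 [/abstraction_some[H Wh ->] eH _]]] := leg.
  have [wfH _ _] := okW.2 _ _ Wh.
  have [u [x [Hu ox _]]] := (contentsP _ _ wfH).1 eH.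
  have [rHu|/eqP nu] := eqVneq (hroot H) (Some u); eexists.
    exact: start_decrease_key_root Wh Hu ox rHu.
  (* The choice of unranked children to move is free; the empty set moves none. *)
  exact: (start_decrease_key_nonroot k fset0) Wh Hu ox nu fv.
- have [m /abstraction_some[H Wh ->] eH] := leg.
  have [wfH _ _] := okW.2 _ _ Wh.
  by apply: start_delete Wh _; apply/in_contents.
Qed.

Lemma exists_exec W op : world_ok W -> legal (abstraction W) op ->
  exists r W', exec W op r W'.
Proof.
move=> okW leg.
have [[h opE]|nq] : (exists h, op = FindMin h) \/ (forall h, op <> FindMin h).
- by case: op {leg} => [|h|e k h|h|h1 h2|e k h|e h]; try by [right|left; exists h].
- move: leg; rewrite opE => /in_domfP[m /abstraction_some[H Wh _]].
  by exists (ReturnItem (find_min H)), W; apply: exec_query.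
have [P st] := exists_start okW leg nq.
have [okP _ _] := correct_start okW leg st.
have [H PH] := terminates_done (phase_ok_terminates okP).
have [h' hW] := exists_fresh_handle W.[\ consumed op].
exists (ReturnHeap h'), W.[\ consumed op].[h' <- H].
by apply: exec_update => //; exists P.
Qed.

Lemma exec_spec W op r W' : world_ok W -> legal (abstraction W) op ->
  exec W op r W' -> spec (returned_min W) (abstraction W) op r (abstraction W').
Proof.
move=> okW leg ex; case: ex leg => [h H Wh _|{}op H h' dur hW leg].
  apply: (spec_find_min (m := contents H)).
  - by rewrite fnd_abstraction Wh.
  - by apply: find_min_is_min; apply: okW.2 Wh.
  - by rewrite /returned_min Wh.
have [[wfH _ _] _ iH] := correct_during okW leg dur.
(* Equality of the maps, not only of their lookups, is needed because the constructors of [spec]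
   name the resulting map. *)
have cH : contents H = outcome (returned_min W) (abstraction W) op.
  apply/fmapP => e; set m := outcome _ _ _.
  have iff k : (contents H).[? e] = Some k <-> m.[? e] = Some k.
    by rewrite contentsP // iH.
  case mE: m.[? e] => [k|]; first by apply/iff.
  by case cE: (contents H).[? e] => [k|] //; move/iff: cE; rewrite mE.
rewrite abstraction_set_rem cH.
have {}hW : h' \notin domf (abstraction W).[\ consumed op].
  by move: hW; rewrite !domf_rem.
have some h m : (abstraction W).[? h] = Some m ->
    odflt [fmap] (abstraction W).[? h] = m by move=> ->.
case: op leg dur hW {iH cH} => [|h|e k h|h|h1 h2|e k h|e h] leg dur hW.
- by move: hW; rewrite /outcome /consumed !remf0; apply: spec_make_heap.
(* No phase starts a [FindMin], so it cannot be executed as an update. *)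
- by case: dur => P st; inversion st.
- have [/in_domfP[m Ah] _] := leg.
  by rewrite /outcome /consumed (some _ _ Ah); apply: spec_insert.
- have [m Ah nonempty] := leg.
  have [J Wh mJ] := abstraction_some Ah; rewrite mJ in nonempty.
  have okJ := okW.2 _ _ Wh; have [e eJ] := find_min_some okJ nonempty.
  have eW : returned_min W h = Some e by rewrite /returned_min Wh.
  rewrite /outcome /consumed eW (some _ _ Ah); apply: spec_delete_min => //.
  by rewrite mJ -eJ; apply: find_min_is_min.
- have [_ [m1 [m2 [A1 A2 _]]]] := leg.
  by rewrite /outcome /consumed (some _ _ A1) (some _ _ A2); apply: spec_meld.
- have [m [k0 [Ah _ _]]] := leg.
  by rewrite /outcome /consumed (some _ _ Ah); apply: spec_decrease_key.
- have [m Ah _] := leg.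
  by rewrite /outcome /consumed (some _ _ Ah); apply: spec_delete.
Qed.

End Forests.

Theorem theorem3p1 (d : Order.disp_t) (K : orderType d) (E : choiceType)
    (W : world K E) (hW : reachable W) :
  [/\ separated W,
      forall h H, W.[? h]%fmap = Some H ->
        heap_ordered_tree H /\ rank_invariant (hnodes H)
    & forall op : operation K E, legal (abstraction W) op ->
        [/\ exists r W', exec W op r W',
            forall Q, during W op Q ->
              [/\ terminates Q, heap_ordered (phase_forest Q)
                & rank_invariant (phase_forest Q)]
          & forall r W', exec W op r W' ->
              spec (returned_min W) (abstraction W) op r (abstraction W')]].
Proof.
have okW := reachable_world_ok hW.
split; first by case: okW.
  move=> h H Wh; have okH := okW.2 _ _ Wh.
  by split; [apply: phase_ok_heap_ordered_tree|apply: wf_rank_invariant; case: okH].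
move=> op leg; split; first exact: exists_exec.
  move=> Q /(correct_during okW leg)[okQ _ _]; have wfQ := phase_ok_wf okQ.
  split; [exact: phase_ok_terminates|exact: wf_heap_ordered|exact: wf_rank_invariant].
by move=> r W'; apply: exec_spec.
Qed.
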